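(* Let $\mathfrak{g}$ be a complex simple Lie algebra with Cartan subalgebra $\mathfrak{h}$, root system $\Phi$, base $\Delta=\{\alpha_1,\dots,\alpha_n\}$, Weyl group $W$, fundamental weights $\omega_1,\dots,\omega_n$ and lattice of abstract weights $\tilde\Lambda$. Let $\mu\in\tilde\Lambda$ be an abstract weight such that $2\mu=(2k)\alpha+\beta$ for some elements $\alpha,\beta\in\Phi$ and some integer $k$. Then all Weyl group orbits $W(\mu)$ are exhausted by the following possibilities, where $k$ is the integer above: $A_1$: $\ \mu=2k+1$. $C_n$, $n\geq3$: $\ \mu=\omega_1+k\alpha_1$; $\ \mu=\omega_1+k\alpha_2$; $\ \mu=\omega_1+k\alpha_n$; $\ \mu=(2k+1)\omega_1=\omega_1+k\beta_{max}$. $C_2$: $\ \mu=\omega_1+k\alpha_1$; $\ \mu=\omega_1+k\alpha_2$; $\ \mu=(2k+1)\omega_1=\omega_1+k\beta_{max}$.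
   Context: $\tilde\Lambda=\{\lambda\in\mathrm{Hom}(\mathfrak{h},\mathbb{C}):\lambda(\tau_\alpha)\in\mathbb{Z}\ \forall\alpha\in\Phi\}$, where $\tau_\alpha=2H_\alpha/B(H_\alpha,H_\alpha)$, $B$ is the Killing form of $\mathfrak{g}$ and $H_\alpha\in\mathfrak{h}$ satisfies $B(H,H_\alpha)=\alpha(H)$ for all $H\in\mathfrak{h}$. The fundamental weights satisfy $\omega_i(\tau_{\alpha_j})=\delta_{ij}$. Simple roots are numbered in the standard (Bourbaki/Humphreys) way; for $C_n$, $\alpha_n$ is the long simple root. $\beta_{max}$ is the highest long root; for $C_n$, $\beta_{max}=2\alpha_1+\dots+2\alpha_{n-1}+\alpha_n=2\omega_1$. For $A_1$ abstract weights are identified with integers by $m\leftrightarrow m\omega_1$.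
   Formalization: The integer k in the listed orbits is taken up to sign (k or −k), as the claim fails for the given k itself: in A_1 with k=1, α=−β, one gets W(μ)={1,−1}, not the orbit of 2k+1=3. *)

(* Defs.v *)
From HB Require Import structures.
From mathcomp Require Import all_boot all_order all_algebra perm.
From mathcomp Require Import boolp classical_sets reals complex.

Set Implicit Arguments.
Unset Strict Implicit.
Unset Printing Implicit Defensive.

Import Order.TTheory GRing.Theory Num.Theory.

Local Open Scope ring_scope.
Local Open Scope classical_set_scope.

Record lie_bracket (C : fieldType) (g : vectType C) := LieBracket {
  br :> g -> g -> g;
  br_linear_r : forall x, linear (br x);
  br_linear_l : forall y, linear (fun x => br x y);
  br_alt : forall x, br x x = 0;
  br_jacobi : forall x y z, br x (br y z) + br y (br z x) + br z (br x y) = 0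
}.

Section Lie.
Variables (C : numClosedFieldType) (g : vectType C) (L : lie_bracket g).

Definition lie_ideal (I : {vspace g}) : Prop :=
  forall x y, y \in I -> L x y \in I.

Definition lie_abelian (U : {vspace g}) : Prop :=
  {in U &, forall x y, L x y = 0}.

Definition lie_simple : Prop :=
  ~ lie_abelian fullv /\
  forall I : {vspace g}, lie_ideal I -> I = 0%VS \/ I = fullv.

Definition ad (x : g) : 'End(g) := linfun (L x).

Definition mx_of_end (f : 'End(g)) := passmx.mxof (vbasis fullv) (vbasis fullv) f.

Definition killing (x y : g) : C := \tr (mx_of_end (ad x \o ad y)%VF).

(* Over an algebraically closed field, an endomorphism is semisimple iff it is
   diagonalizable. *)
Definition ad_semisimple (x : g) : Prop := diagonalizable (mx_of_end (ad x)).

(* Cartan subalgebra of a complex semisimple Lie algebra: a maximal abelian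
   subalgebra all of whose elements are ad-semisimple.  (A subspace on which
   the bracket vanishes is automatically a subalgebra.) *)
Definition cartan_subalgebra (h : {vspace g}) : Prop :=
  [/\ lie_abelian h,
      forall h' : {vspace g}, lie_abelian h' -> (h <= h')%VS -> h' = h
    & {in h, forall x, ad_semisimple x}].

Variable h : {vspace g}.

Definition dual := 'Hom(subvs_of h, C^o).

Definition is_root (a : dual) : Prop :=
  a != 0 /\ exists2 x : g, x != 0 &
    forall H : subvs_of h, L (vsval H) x = (a H : C) *: x.

Definition killing_h (H K : subvs_of h) : C := killing (vsval H) (vsval K).

(* The element H_a of h with B(H, H_a) = a(H) for all H in h; it exists and is
   unique when g is simple.  The default value 0 is irrelevant in that case. *)
Definition coroot_H (a : dual) : subvs_of h :=
  xget 0 [set K | forall H, killing_h H K = a H].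

Definition norm2 (a : dual) : C := killing_h (coroot_H a) (coroot_H a).

Definition tau (a : dual) : subvs_of h := (2 / norm2 a) *: coroot_H a.

Definition abstract_weight (mu : dual) : Prop :=
  forall a, is_root a -> exists m : int, mu (tau a) = m%:~R.

Definition reflection (a mu : dual) : dual := mu - (mu (tau a) : C) *: a.

Inductive weyl : (dual -> dual) -> Prop :=
| weyl1 : weyl id
| weylM a w : is_root a -> weyl w -> weyl (reflection a \o w).

Definition weyl_orbit (mu : dual) : set dual :=
  [set nu | exists2 w, weyl w & nu = w mu].

Section Base.
(* The rank of a simple Lie algebra is positive; it is written l.+1, and the
   simple root numbered i in the literature has index i - 1 here. *)
Variables (l : nat) (alpha : 'I_l.+1 -> dual).

Definition nonneg_comb (b : dual) : Prop :=
  exists c : 'I_l.+1 -> nat, b = \sum_i alpha i *+ c i.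

Definition is_base : Prop :=
  [/\ forall i, is_root (alpha i),
      basis_of fullv (mktuple alpha)
    & forall b, is_root b -> nonneg_comb b \/ nonneg_comb (- b)].

Definition fundamental_weights (omega : 'I_l.+1 -> dual) : Prop :=
  forall i j, omega i (tau (alpha j)) = (i == j)%:R.

Definition long_root (b : dual) : Prop :=
  is_root b /\ forall c, is_root c -> norm2 c <= norm2 b.

Definition highest_long_root (b : dual) : Prop :=
  long_root b /\ forall c, long_root c -> nonneg_comb (b - c).

(* The numbers alpha_i(tau_{alpha_j}) of the Bourbaki-numbered C_{l+1}, the
   last simple root being the long one. *)
Definition cartan_C (i j : 'I_l.+1) : int :=
  if i == j then 2
  else if j == i.+1 :> nat then -1
  else if i == j.+1 :> nat then (if i == ord_max then -2 else -1)
  else 0.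

Definition numbered_C : Prop :=
  forall i j, alpha i (tau (alpha j)) = (cartan_C i j)%:~R.

End Base.

End Lie.

(* Main.v *)
Require Import Defs.
From HB Require Import structures.
From mathcomp Require Import all_boot all_order all_algebra perm.
From mathcomp Require Import boolp classical_sets reals complex.
From mathcomp Require Import zify ring.

Set Implicit Arguments.
Unset Strict Implicit.
Unset Printing Implicit Defensive.

Import Order.TTheory GRing.Theory Num.Theory.
Import passmx.

Local Open Scope ring_scope.
Local Open Scope classical_set_scope.

(** Suppose 2 mu = 2 k a + b with mu a weight and a, b roots. Then b is even: it
    takes even values on all coroots. The whole proposition rests on the fact
    that an irreducible root system with an even root is of type C (or A_1), that
    root being long.

    Two members of the Weyl orbit of an even root have the same norm and an even
    pairing, so positivity leaves only three possibilities: they are equal,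
    opposite or orthogonal ([orbit_trichotomy]). A root c which is not orthogonal
    to a member b of the orbit, and is not b or -b, maps b to an orthogonal
    member, and c is half of the difference of the two
    ([root_not_orthogonal]). By irreducibility every root is in the orbit or is
    such a half difference ([root_shape]), and all half differences of
    orthogonal members occur ([half_difference_root]). So the orbit consists of
    the vectors 2 e_i and -2 e_i, and the roots are those of the usual model of
    type C. Numbering the e_i by decreasing height, the roots e_i - e_(i+1) and
    2 e_n generate all positive roots, hence are the given simple roots in some
    order ([orthogonal_frame], [simple_is_standard]); then the first fundamental
    weight is e_1 and the highest long root is 2 e_1.

    After applying an element of the Weyl group, b = 2 e_1 and mu = e_1 + k a.
    The stabilizer of e_1 contains all sign changes and permutations of the other
    e_i; it moves a, up to a sign which is absorbed in k, to 2 e_1, 2 e_n,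
    e_1 - e_2 or e_2 - e_3 ([root_normal_form]). These are the listed cases. For
    the converse one only has to know that twice the first fundamental weight is
    a root, because it is in the orbit of the long simple root
    ([double_omega_root_C]).

    The properties of root systems which this uses are derived from the
    definition of a simple Lie algebra. As fundamental weights exist, the simple
    roots have nonzero coroots, so the Killing form is nondegenerate on the Cartan
    subalgebra ([corootP]), and then on the whole algebra because its radical is
    an ideal. A lowest weight argument shows that root spaces are lines and that
    doubles of roots are not roots ([no_lowest_vector]). The rest comes from one
    identity: for root vectors x and y of opposite weights with nonzero product,
    their bracket is a multiple of the coroot and has trace 0 on every sum of
    weight spaces preserved by x and y ([trace_coroot]). Applied to a string of weights, it shows that roots are not isotropic and that pairings of
    roots with coroots are integers given by the ends of the string. *)

(** * Brackets and the Killing form *)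

Section LieAlgebra.
Variables (C : numClosedFieldType) (g : vectType C) (L : lie_bracket g).

HB.instance Definition _ x :=
  GRing.isLinear.Build C g g _ (br L x) (br_linear_r L x).

Lemma brC x y : L x y = - L y x.
Proof.
have Dl a b z : L (a + b) z = L a z + L b z.
  by have := br_linear_l L z 1 a b; rewrite !scale1r.
apply/eqP; rewrite -addr_eq0.
have := br_alt L (x + y).
by rewrite Dl !linearD /= !br_alt add0r addr0 => ->.
Qed.

Lemma brDl x y z : L (x + y) z = L x z + L y z.
Proof. by rewrite brC linearD opprD -!brC. Qed.

Lemma brZl a x z : L (a *: x) z = a *: L x z.
Proof. by rewrite brC linearZ -scalerN -brC. Qed.

Lemma br0l z : L 0 z = 0.
Proof. by rewrite brC linear0 oppr0. Qed.

Lemma brNl x z : L (- x) z = - L x z.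
Proof. by rewrite -scaleN1r brZl scaleN1r. Qed.

Lemma br_suml I (r : seq I) (P : pred I) (F : I -> g) z :
  L (\sum_(i <- r | P i) F i) z = \sum_(i <- r | P i) L (F i) z.
Proof.
by rewrite brC linear_sum -sumrN; apply: eq_bigr => i _; rewrite -brC.
Qed.

Lemma br_brl x y z : L (L x y) z = L x (L y z) - L y (L x z).
Proof.
have := br_jacobi L x y z; rewrite (brC z (L x y)) (brC z x) linearN.
by move/eqP; rewrite subr_eq0 => /eqP <-.
Qed.

Lemma br_der x y z : L x (L y z) = L (L x y) z + L y (L x z).
Proof. by rewrite br_brl subrK. Qed.

Lemma adE x y : ad L x y = L x y.
Proof. by rewrite lfunE. Qed.

(** The matrices in the definition of the Killing form refer to a fixed basis;
    traces are needed in a basis of weight vectors. *)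
Lemma trace_basis (e : (\dim {:g}).-tuple g) (f : 'End(g)) :
  basis_of fullv e -> \tr (mx_of_end f) = \sum_i coord e i (f e`_i).
Proof.
move=> eB; have bB := vbasisP {:g}.
transitivity (\tr (mxof e e f)).
  have -> : mxof e e f =
      mxof e (vbasis {:g}) \1%VF *m
        (mx_of_end f *m mxof (vbasis {:g}) e \1%VF).
    rewrite -!(mxof_comp _ _ bB); congr mxof.
    by apply/lfunP=> v; rewrite !comp_lfunE !id_lfunE.
  rewrite mxtrace_mulC -mulmxA -(mxof_comp _ _ eB).
  rewrite -[LHS]/(\tr (mx_of_end f)); congr (\tr _).
  rewrite (_ : (_ \o _)%VF = \1%VF) ?mxof1 ?mulmx1 ?(basis_free bB) //.
  by apply/lfunP=> v; rewrite comp_lfunE id_lfunE.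
by apply: eq_bigr => i _; rewrite mxE /= mxE vecof_delta.
Qed.

Lemma killingE (e : (\dim {:g}).-tuple g) x y : basis_of fullv e ->
  killing L x y = \sum_i coord e i (L x (L y e`_i)).
Proof.
move=> eB; rewrite /killing (trace_basis _ eB).
by apply: eq_bigr => i _; rewrite comp_lfunE !adE.
Qed.

Let M x := mx_of_end (ad L x).

Let killing_mx x y : killing L x y = \tr (M y *m M x).
Proof. by rewrite /killing /mx_of_end (mxof_comp _ _ (vbasisP {:g})). Qed.

Lemma killingC x y : killing L x y = killing L y x.
Proof. by rewrite !killing_mx mxtrace_mulC. Qed.

(* Matrices act on rows, so composition is reversed. *)
Let ad_br x y : M (L x y) = M y *m M x - M x *m M y.
Proof.
rewrite /M /mx_of_end.
have -> : ad L (L x y) = -1 *: (ad L y \o ad L x)%VF + (ad L x \o ad L y)%VF.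
  apply/lfunP=> v; rewrite add_lfunE scale_lfunE !comp_lfunE !adE br_brl.
  by rewrite scaleN1r addrC.
rewrite mxof_linear scaleN1r addrC.
by rewrite !(mxof_comp _ _ (vbasisP {:g})).
Qed.

Lemma killing_invariant x y z : killing L (L x y) z = killing L x (L y z).
Proof.
rewrite !killing_mx !ad_br mulmxBr mulmxBl !raddfB /= !mulmxA; congr (_ - _).
by rewrite -[in RHS]mulmxA [RHS]mxtrace_mulC.
Qed.

Lemma killing_linear x : linear (killing L x : g -> C^o).
Proof.
move=> a y z; rewrite !(killingE _ _ (vbasisP {:g})).
rewrite -[X in _ = X + _]/(a * _) mulr_sumr.
rewrite -big_split; apply: eq_bigr => i _.
by rewrite brDl brZl !linearP.
Qed.

HB.instance Definition _ x :=
  GRing.isLinear.Build C g C^o _ (killing L x) (killing_linear x).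

(** A trace of a commutator vanishes, also on a subspace which both factors
    preserve; here the subspace is spanned by part of a basis. *)
Lemma trace_br_stable (e : (\dim {:g}).-tuple g) (S : pred 'I_(\dim {:g})) x y :
    basis_of fullv e ->
    (forall i j, S i -> ~~ S j -> coord e j (L x e`_i) = 0) ->
    (forall i j, S i -> ~~ S j -> coord e j (L y e`_i) = 0) ->
  \sum_(i | S i) coord e i (L (L x y) e`_i) = 0.
Proof.
move=> eB Sx Sy.
have E u v i : (forall i j, S i -> ~~ S j -> coord e j (L u e`_i) = 0) -> S i ->
    coord e i (L v (L u e`_i)) =
      \sum_(j | S j) coord e j (L u e`_i) * coord e i (L v e`_j).
  move=> Su Si; rewrite [in LHS](coord_basis eB (memvf (L u e`_i))).
  rewrite !linear_sum /= (bigID S) /= [X in _ + X]big1 ?addr0.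
    by apply: eq_bigr => j _; rewrite !linearZ.
  by move=> j Sj; rewrite Su // scale0r !linear0.
under eq_bigr => i Si do rewrite br_brl linearB /= (E y x) // (E x y) //.
rewrite sumrB [X in _ - X]exchange_big /=; apply/eqP.
rewrite subr_eq0; apply/eqP; apply: eq_bigr => i _; apply: eq_bigr => j _.
by rewrite mulrC.
Qed.

End LieAlgebra.

(** * Simultaneous eigenvectors of the Cartan subalgebra *)

Section Cartan.
Variables (C : numClosedFieldType) (g : vectType C) (L : lie_bracket g).
Variable h : {vspace g}.
Hypothesis cartan_h : cartan_subalgebra L h.

Definition has_weight (a : dual h) (v : g) : Prop :=
  forall H : subvs_of h, L (vsval H) v = (a H : C) *: v.

Lemma has_weight_br a b x y :
  has_weight a x -> has_weight b y -> has_weight (a + b) (L x y).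
Proof.
move=> ax bY H; rewrite br_der ax bY brZl linearZ /= -scalerDl.
by rewrite add_lfunE.
Qed.

Lemma has_weightB a x y :
  has_weight a x -> has_weight a y -> has_weight a (x - y).
Proof. by move=> ax ay H; rewrite linearB /= ax ay scalerBr. Qed.

Lemma has_weightZ a c x : has_weight a x -> has_weight a (c *: x).
Proof. by move=> ax H; rewrite linearZ /= ax scalerA mulrC -scalerA. Qed.

Lemma cartan_abelian x y : x \in h -> y \in h -> L x y = 0.
Proof. by case: cartan_h => hA _ _; exact: hA. Qed.

(** A vector which commutes with the Cartan subalgebra could be adjoined to it,
    so maximality puts it inside. *)
Lemma has_weight0 x : has_weight 0 x <-> x \in h.
Proof.
split=> [x0|xh H]; last first.
  by rewrite lfunE scale0r cartan_abelian // subvsP.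
have x0' y : y \in h -> L y x = 0.
  by move=> yh; have := x0 (Subvs yh); rewrite lfunE scale0r.
case: cartan_h => _ hmax _.
suff <- : (h + <[x]>)%VS = h by rewrite (subvP (addvSr _ _)) // memv_line.
apply: hmax (addvSl _ _).
move=> _ _ /memv_addP[u uh [_ /vlineP[c ->] ->]]
  /memv_addP[v vh [_ /vlineP[d ->] ->]].
rewrite brDl !linearD /= !linearZ /= !brZl br_alt (cartan_abelian uh vh).
by rewrite x0' // (brC L x v) x0' // oppr0 !scaler0 !addr0.
Qed.

(** The commuting diagonalizable matrices of a basis of the Cartan subalgebra are
    diagonalized simultaneously. *)
Lemma eigenbasis : exists (e : (\dim {:g}).-tuple g)
    (lam : 'I_(\dim {:g}) -> dual h),
  basis_of fullv e /\ forall i, has_weight (lam i) e`_i.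
Proof.
pose b := vbasis {:g}; have bB : basis_of fullv b := vbasisP _.
pose As := [seq mx_of_end (ad L (vsval H)) | H <- vbasis {: subvs_of h}].
have [P Pu /allP PD] : codiagonalizable As.
  apply/codiagonalizableP; split=> [_ _ /mapP[H _ ->] /mapP[K _ ->]|].
    rewrite /comm_mx -!(mxof_comp _ _ bB); congr mxof.
    apply/lfunP=> v; rewrite !comp_lfunE !adE br_der.
    by rewrite (cartan_abelian (subvsP _) (subvsP _)) br0l add0r.
  move=> _ /mapP[H _ ->]; case: cartan_h => _ _; apply; exact: subvsP.
pose e := mktuple (fun i => vecof b (row i P)).
have eE (i : 'I_ _) : e`_i = vecof b (row i P) by rewrite -tnth_nth tnth_mktuple.
have eB : basis_of fullv e.
  rewrite basisEfree subvf size_tuple leqnn andbT andbT.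
  apply/freeP => k kE i.
  suff /rowP/(_ i) : \row_i k i = 0 by rewrite !mxE.
  apply: (can_inj (mulmxK Pu)); rewrite mul0mx mulmx_sum_row.
  apply/eqP; rewrite -(vecof_eq0 bB) linear_sum /= -{2}kE; apply/eqP.
  by apply: eq_bigr => j _; rewrite mxE linearZ /= eE.
clearbody e.
(* Checked on a basis of the Cartan subalgebra, where P diagonalizes. *)
have eig (i : 'I_(\dim {:g})) (H : subvs_of h) :
    L (vsval H) e`_i = coord e i (L (vsval H) e`_i) *: e`_i.
  rewrite (coord_basis (vbasisP {: subvs_of h}) (memvf H)).
  rewrite linear_sum br_suml linear_sum scaler_suml; apply: eq_bigr => j _ /=.
  rewrite brZl linearZ /= -scalerA; congr (_ *: _).
  set K := _`_j.
  have /PD /= Kdiag : mx_of_end (ad L (vsval K)) \in As.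
    apply: map_f; apply: mem_nth; by rewrite size_tuple.
  suff [c ->] : exists c, L (vsval K) e`_i = c *: e`_i.
    by rewrite linearZ /= coord_free ?(basis_free eB) // eqxx mulr1.
  set D := conjmx P (mx_of_end (ad L (vsval K))).
  have /is_diag_mxP Dd : is_diag_mx D by exact: Kdiag.
  exists (D i i); rewrite eE -adE (hom_vecof _ bB) -linearZ; congr vecof.
  have PD' : P *m mx_of_end (ad L (vsval K)) = D *m P.
    by rewrite /D conjumx // mulmxKV.
  rewrite -[mxof _ _ _]/(mx_of_end _) -row_mul PD' row_mul.
  rewrite mulmx_sum_row (bigD1 i) //= big1 ?addr0 ?mxE // => j' ne.
  by rewrite mxE Dd ?scale0r // eq_sym.
pose lam i : dual h :=
  (linfun (coord e i : g -> C^o) \o ad L (- e`_i) \o linfun vsval)%VF.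
exists e, lam; split=> // i H.
rewrite /lam !comp_lfunE adE !lfunE /= brNl -brC.
exact: eig.
Qed.
End Cartan.

(** The Killing form transported to the dual of the Cartan subalgebra: [coroot_H]
    is the inverse of the isomorphism which that form induces. *)
Definition ip (C : numClosedFieldType) (g : vectType C) (L : lie_bracket g)
  (h : {vspace g}) (b a : dual h) : C := b (coroot_H L a).

(** * Root spaces *)

Section RootSpaces.
Variables (C : numClosedFieldType) (g : vectType C) (L : lie_bracket g).
Variable h : {vspace g}.
Hypothesis simple_g : lie_simple L.
Hypothesis cartan_h : cartan_subalgebra L h.
Hypothesis corootP : forall (v : dual h) H, killing_h L H (coroot_H L v) = v H.

Variables (e : (\dim {:g}).-tuple g) (lam : 'I_(\dim {:g}) -> dual h).
Hypothesis eB : basis_of fullv e.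
Hypothesis e_weight : forall i, has_weight L (lam i) e`_i.

Implicit Types a b : dual h.

Lemma coord_cartan (H : subvs_of h) v i :
  coord e i (L (vsval H) v) = lam i H * coord e i v.
Proof.
rewrite {1}(coord_basis eB (memvf v)) !linear_sum /= (bigD1 i) //= big1.
  rewrite addr0 linearZ /= e_weight !linearZ /= coord_free ?(basis_free eB) //.
  by rewrite eqxx mulr1 mulrC.
move=> j ne; rewrite linearZ /= e_weight !linearZ /= coord_free ?(basis_free eB) //.
by rewrite (negPf ne) !mulr0.
Qed.

Lemma weight_coord a v i : has_weight L a v -> coord e i v != 0 -> lam i = a.
Proof.
move=> av nz; apply/lfunP => H; apply: (mulIf nz).
by rewrite -coord_cartan av linearZ.
Qed.

Lemma weight_sum (a : dual h) v : has_weight L a v ->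
  v = \sum_(i | lam i == a) coord e i v *: e`_i.
Proof.
move=> av; rewrite {1}(coord_basis eB (memvf v)) (bigID (fun i => lam i == a)) /=.
rewrite [X in _ + X]big1 ?addr0 // => i ne; have [->|nz] := eqVneq (coord e i v) 0.
  by rewrite scale0r.
by rewrite (weight_coord av nz) eqxx in ne.
Qed.

Lemma weight_occurs a v : has_weight L a v -> v != 0 -> exists i, lam i = a.
Proof.
move=> av nz; have [i /eqP <-|no] := pickP (fun i => lam i == a); first by exists i.
by case/negP: nz; rewrite (weight_sum av) big_pred0.
Qed.

Lemma e_neq0 (i : 'I_(\dim {:g})) : e`_i != 0.
Proof. by apply: (free_not0 (basis_free eB)); rewrite mem_nth ?size_tuple. Qed.

Lemma is_rootE a : is_root L a <-> a != 0 /\ exists i, lam i = a.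
Proof.
split=> [[a0 [x x0 ax]]|[a0 [i lia]]]; first by split; last exact: weight_occurs ax x0.
split=> //; exists e`_i; first exact: e_neq0.
by rewrite -lia; exact: e_weight.
Qed.

Lemma is_root_lam i : lam i != 0 -> is_root L (lam i).
Proof. by move=> ?; apply/is_rootE; split; last exists i. Qed.

Lemma killing_weight (a b : dual h) x y :
  has_weight L a x -> has_weight L b y -> a + b != 0 -> killing L x y = 0.
Proof.
move=> ax bY ab0; rewrite (killingE _ _ _ eB) big1 // => i _.
have W := has_weight_br ax (has_weight_br bY (e_weight i)).
apply/eqP/negP => /negP /(weight_coord W) /eqP.
by rewrite addrA -subr_eq0 opprD addrCA subrr addr0 oppr_eq0 (negPf ab0).
Qed.

Lemma killing_hE (H K : subvs_of h) : killing_h L H K = \sum_i lam i H * lam i K.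
Proof.
rewrite /killing_h (killingE _ _ _ eB); apply: eq_bigr => i _.
by rewrite !coord_cartan coord_free ?(basis_free eB) // eqxx mulr1.
Qed.

Lemma killing_hC (H K : subvs_of h) : killing_h L H K = killing_h L K H.
Proof. exact: killingC. Qed.

Lemma dual_separates (K : subvs_of h) : (forall v : dual h, v K = 0) -> K = 0.
Proof.
move=> vK; rewrite (coord_basis (vbasisP {: subvs_of h}) (memvf K)) big1 // => i _.
have := vK (linfun (coord (vbasis {: subvs_of h}) i : subvs_of h -> C^o)).
by rewrite lfunE /= => ->; rewrite scale0r.
Qed.

(** Every linear form is a Killing product with some element, so an element of the
    radical is killed by all linear forms. *)
Lemma killing_h_nondeg (K : subvs_of h) : (forall H, killing_h L H K = 0) -> K = 0.
Proof.
by move=> HK; apply: dual_separates => v; rewrite -corootP killing_hC HK.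
Qed.

(** The radical of the Killing form is an ideal. If it were everything, all weights
    would vanish, and the algebra would equal its abelian Cartan subalgebra. *)
Lemma killing_e_neq0 x : x != 0 -> exists i : 'I_(\dim {:g}), killing L x e`_i != 0.
Proof.
move=> x0; apply: contrapT => no.
pose I := (\bigcap_(i < \dim {:g}) lker (linfun (killing L e`_i : g -> C^o)))%VS.
have memI y : y \in I <-> forall z, killing L z y = 0.
  split=> [/subv_bigcapP yI z|yI]; last first.
    by apply/subv_bigcapP => i _; rewrite -memvE memv_ker lfunE /= yI.
  rewrite killingC (coord_basis eB (memvf z)) linear_sum big1 // => i _.
  have := yI i isT; rewrite -memvE memv_ker lfunE /= => /eqP.
  by rewrite linearZ /= killingC => ->; rewrite scaler0.
have [_ /(_ I)[]] := simple_g.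
- move=> y z /memI zI; apply/memI => t.
  by rewrite -killing_invariant zI.
- move=> I0; have : x \in I.
    apply/memI => z.
    rewrite killingC (coord_basis eB (memvf z)) linear_sum big1 // => i _.
    rewrite linearZ /=; have [->|nz] := eqVneq (killing L x e`_i) 0.
      by rewrite scaler0.
    by case: no; exists i.
  by rewrite I0 memv0 (negPf x0).
- move=> IT; have kill0 y z : killing L z y = 0.
    by move: z; apply/memI; rewrite IT memvf.
  have lam0 i : lam i = 0.
    by apply/lfunP=> H; rewrite -corootP /killing_h kill0 lfunE.
  case: simple_g => + _; apply=> u v _ _.
  have inh w : w \in h.
    apply/(has_weight0 cartan_h) => H; rewrite lfunE scale0r.
    rewrite (coord_basis eB (memvf w)) linear_sum big1 // => i _.
    by rewrite linearZ /= e_weight lam0 lfunE scale0r scaler0.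
  by rewrite (cartan_abelian cartan_h).
Qed.

(** Only opposite weight spaces have nonzero Killing products. *)
Lemma opp_weight (a : dual h) x : has_weight L a x -> x != 0 ->
  exists2 i, lam i = - a & killing L x e`_i != 0.
Proof.
move=> ax /killing_e_neq0[i nz]; exists i => //; apply/eqP.
rewrite -addr_eq0 addrC; apply: contraNT nz => /(killing_weight ax (e_weight i)) ->.
by rewrite eqxx.
Qed.

(** Both sides lie in the Cartan subalgebra and, by invariance, have the same
    Killing product with each of its elements. *)
Lemma br_opp (a : dual h) x y : has_weight L a x -> has_weight L (- a) y ->
  L x y = killing L x y *: vsval (coroot_H L a).
Proof.
move=> ax ay; have xyh : L x y \in h.
  by apply/(has_weight0 cartan_h); rewrite -(subrr a); exact: has_weight_br.
pose K := Subvs xyh; suff E : K = killing L x y *: coroot_H L a.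
  by rewrite -[L x y in LHS]/(vsval K) E linearZ.
apply/eqP; rewrite -subr_eq0; apply/eqP/killing_h_nondeg => H.
rewrite /killing_h !linearB /= !linearZ /=.
rewrite -[killing _ _ (vsval (coroot_H _ _))]/(killing_h L _ _).
rewrite corootP -killing_invariant ax killingC linearZ /= killingC.
by rewrite [_ *: _]mulrC subrr.
Qed.

Local Notation ip := (@ip C g L h).

Lemma ipC b a : ip b a = ip a b.
Proof. by rewrite /ip -!corootP killing_hC. Qed.

Lemma ipDl a b c : ip (a + b) c = ip a c + ip b c.
Proof. by rewrite /ip add_lfunE. Qed.

Lemma ipZl k a c : ip (k *: a) c = k * ip a c.
Proof. by rewrite /ip scale_lfunE. Qed.

Lemma norm2E a : norm2 L a = ip a a.
Proof. by rewrite /norm2 corootP. Qed.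

(** The trace form is a sum over all weights, with multiplicity. *)
Lemma ip_sum a b : ip a b = \sum_i ip (lam i) a * ip (lam i) b.
Proof. by rewrite -[LHS]corootP killing_hC -killing_hE killing_hC. Qed.

Lemma ip_weights_eq0 v : (forall i, ip (lam i) v = 0) -> v = 0.
Proof.
move=> lv; apply/lfunP => H; rewrite -corootP killing_hE lfunE big1 // => i _.
by rewrite -[X in _ * X]/(ip _ _) lv mulr0.
Qed.

Lemma mulrn_dual_inj (a : dual h) : a != 0 -> injective (GRing.natmul a).
Proof.
move=> a0 n m /eqP; rewrite -!scaler_nat -subr_eq0 -scalerBl scaler_eq0.
by rewrite (negPf a0) orbF subr_eq0 eqr_nat => /eqP.
Qed.

(** Stands for the finite dimension of g in all arguments with strings. *)
Lemma weights_finite (b a : dual h) : a != 0 ->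
  ~ (forall n : nat, exists i, lam i = b + a *+ n).
Proof.
move=> a0 /choice[f fE].
have : injective (fun n : 'I_(\dim {:g}).+1 => f n).
  move=> n m /(congr1 lam); rewrite !fE => /addrI /(mulrn_dual_inj a0).
  exact: val_inj.
by move/leq_card; rewrite !card_ord ltnn.
Qed.

(** Here [x, y] is a multiple of the coroot, so on a part of g which x and y
    preserve the trace of the coroot vanishes. *)
Lemma trace_coroot (a : dual h) x y (S : pred 'I_(\dim {:g})) :
    has_weight L a x -> has_weight L (- a) y -> killing L x y != 0 ->
    (forall i j, S i -> lam j = lam i + a -> S j) ->
    (forall i j, S i -> lam j = lam i - a -> S j) ->
  \sum_(i | S i) ip (lam i) a = 0.
Proof.
move=> ax ay k0 Sp Sm; apply: (mulfI k0); rewrite mulr0 mulr_sumr.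
transitivity (\sum_(i | S i) coord e i (L (L x y) e`_i)).
  apply: eq_bigr => i _; rewrite (br_opp ax ay) brZl e_weight !linearZ /=.
  by rewrite coord_free ?(basis_free eB) // eqxx mulr1.
apply: (trace_br_stable eB).
- move=> i j Si Sj; apply/eqP; apply: contraNT Sj.
  by move/(weight_coord (has_weight_br ax (e_weight i))); rewrite addrC; exact: Sp.
- move=> i j Si Sj; apply/eqP; apply: contraNT Sj.
  by move/(weight_coord (has_weight_br ay (e_weight i))); rewrite addrC; exact: Sm.
Qed.

Lemma root_vectors a : is_root L a -> exists x y,
  [/\ has_weight L a x, has_weight L (- a) y, x != 0 & killing L x y != 0].
Proof.
case=> a0 [x x0 ax]; have [i li k0] := opp_weight ax x0.
by exists x, e`_i; split=> //; rewrite -li.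
Qed.

(** All weights of an a-string have the same product with an isotropic root a. The
    sum of these products is a trace which vanishes, so each of them is 0, and a
    would be orthogonal to all weights. *)
Lemma root_nonisotropic a : is_root L a -> ip a a != 0.
Proof.
move=> ra; have [x [y [ax ay x0 k0]]] := root_vectors ra.
apply/negP => /eqP aa; case: ra => a0 _; case/eqP: a0.
apply: ip_weights_eq0 => j.
pose S i := `[< exists n : int, lam i = lam j + a *~ n >].
have := trace_coroot (S := S) ax ay k0.
have -> : \sum_(i | S i) ip (lam i) a = ip (lam j) a *+ #|S|.
  rewrite -sumr_const; apply: eq_bigr => i /asboolP[n ->].
  by rewrite ipDl -scaler_int ipZl aa mulr0 addr0.
move=> E; have /eqP : ip (lam j) a *+ #|S| = 0.
  apply: E => i k /asboolP[n li] lk; apply/asboolP; rewrite lk li.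
    by exists (n + 1); rewrite mulrzDr mulr1z addrA.
  by exists (n - 1); rewrite mulrzBr mulr1z addrA.
rewrite mulrn_eq0 => /orP[|/eqP //]; rewrite -leqn0 leqNgt => /negP[].
by apply/card_gt0P; exists j; apply/asboolP; exists 0; rewrite mulr0z addr0.
Qed.

(** The lowest weight argument for the copy of sl_2 spanned by x, y and their
    bracket: raising z repeatedly never gives 0, because y undoes each step up
    to a nonzero factor, but g has finitely many weights. *)
Lemma no_lowest_vector a m x y z : is_root L a ->
    has_weight L a x -> has_weight L (- a) y -> killing L x y != 0 ->
    has_weight L (a *+ m.+1) z -> L x (L y z) = 0 -> z = 0.
Proof.
move=> ra ax ay k0 az xyz; apply/eqP/negP => /negP z0.
pose u n := iter n (L x) z; pose t := killing L x y * ip a a.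
have t0 : t != 0 by rewrite mulf_neq0 // root_nonisotropic.
have uw n : has_weight L (a *+ (m.+1 + n)) (u n).
  elim: n => [|n IH]; first by rewrite addn0.
  by rewrite addnS mulrS; exact: has_weight_br ax IH.
have yx n c : L x (L y (u n)) = - (c%:R * t) *: u n ->
    L y (u n.+1) = - ((c + (m.+1 + n))%:R * t) *: u n.
  move=> E; rewrite [u n.+1]/= -/(u n) br_der E (brC L y x) brNl (br_opp ax ay).
  rewrite brZl uw scalerA -scaleNr -scalerDl natrD mulrDl opprD addrC.
  congr ((_ - _) *: _); rewrite -scaler_nat -[LHS]/(killing L x y * ip _ _).
  by rewrite ipZl mulrCA.
have IH n : u n != 0 /\ exists c, L x (L y (u n)) = - (c%:R * t) *: u n.
  elim: n => [|n [un0 [c E]]].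
    by split=> //; exists 0%N; rewrite xyz mul0r oppr0 scale0r.
  have yu := yx _ _ E; split; last first.
    by exists (c + (m.+1 + n))%N; rewrite yu linearZ.
  apply: contraNneq un0 => un; move/eqP: yu; rewrite un linear0 eq_sym scaler_eq0.
  by rewrite oppr_eq0 mulf_eq0 (negPf t0) orbF pnatr_eq0 addnC addSn.
have a0 : a != 0 by case: ra.
apply: (@weights_finite (a *+ m.+1) a a0) => n.
by rewrite -mulrnDr; apply: weight_occurs (uw n) _; case: (IH n).
Qed.

(** Subtracting a multiple of x makes the product with a vector y of opposite
    weight vanish; the difference is then killed by y, hence is 0. *)
Lemma root_space_dim1 a x z : is_root L a -> has_weight L a x -> x != 0 ->
  has_weight L a z -> exists c, z = c *: x.
Proof.
move=> ra ax x0 az; have [i li k0] := opp_weight ax x0.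
have ay : has_weight L (- a) e`_i by rewrite -li.
pose c := killing L z e`_i / killing L x e`_i; exists c.
have w : has_weight L a (z - c *: x) by apply: has_weightB => //; exact: has_weightZ.
apply/eqP; rewrite -subr_eq0; apply/eqP.
apply: (@no_lowest_vector a 0 x e`_i) => //.
have w' : has_weight L (- - a) (z - c *: x) by rewrite opprK.
have k1 : killing L e`_i (z - c *: x) = 0.
  rewrite linearB linearZ /= !(killingC L e`_i) -[_ *: _]/(_ * _) /c divfK //.
  by rewrite subrr.
by rewrite (br_opp ay w') k1 scale0r linear0.
Qed.

(** For z of weight 2a, the bracket of y and z has weight a, so it is a multiple
    of x and commutes with x. *)
Lemma double_not_root a : is_root L a -> ~ is_root L (a *+ 2).
Proof.
move=> ra [_ [z z0 az]]; have [x [y [ax ay x0 k0]]] := root_vectors ra.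
case/eqP: z0; apply: (@no_lowest_vector a 1 x y) => //.
have yz : has_weight L a (L y z).
  by rewrite -[a](addKr a) -mulr2n; exact: has_weight_br.
have [c ->] := root_space_dim1 ra ax x0 yz.
by rewrite linearZ /= br_alt scaler0.
Qed.

Lemma weight_card1 a : is_root L a -> #|[pred i | lam i == a]| = 1%N.
Proof.
move=> ra; have [_ [i li]] := (is_rootE a).1 ra.
apply: (eq_card1 (x := i)) => j; rewrite !inE.
apply/eqP/eqP => [lj|-> //].
have wi : has_weight L a e`_i by rewrite -li.
have wj : has_weight L a e`_j by rewrite -lj.
have [c E] := root_space_dim1 ra wi (e_neq0 i) wj.
have /eqP := congr1 (coord e j) E; rewrite linearZ /= !coord_free ?(basis_free eB) //.
by rewrite eqxx; case: (eqVneq i j) => [-> //|_]; rewrite mulr0 oner_eq0.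
Qed.

Lemma opp_root a : is_root L a -> is_root L (- a).
Proof.
move=> ra; have [a0 _] := ra; have [x [y [ax ay x0 k0]]] := root_vectors ra.
split; first by rewrite oppr_eq0.
by exists y => //; apply: contraNneq k0 => ->; rewrite linear0.
Qed.

Lemma pairE (v a : dual h) : v (tau L a) = 2 * ip v a / ip a a.
Proof. by rewrite /tau linearZ /= norm2E [LHS]mulrAC. Qed.

(** The trace of the coroot on the part of g along the a-string through b
    vanishes; as root spaces are lines this computes the pairing from the two
    ends of the string. *)
Lemma root_string a b : is_root L a -> is_root L b -> (forall n : int, b != a *~ n) ->
  exists n : int, b (tau L a) = n%:~R /\ is_root L (b - a *~ n).
Proof.
move=> ra rb nab; have a0 : a != 0 by case: ra.
(* The string is described by its lowest weight b0, p steps below b, and its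
   length m. *)
pose inc (c : dual h) := [exists i, lam i == c].
have incP c : reflect (exists i, lam i = c) (inc c).
  by apply: (iffP existsP) => -[i /eqP]; exists i => //; apply/eqP.
have fin (c d : dual h) : d != 0 -> exists n, ~~ inc (c + d *+ n).
  move=> d0; apply: contrapT => no; apply: (@weights_finite c d d0) => n.
  by apply/incP; apply: contrapT => /negP ni; apply: no; exists n.
have incb : inc b by apply/incP; case/is_rootE: rb.
have exp : exists p, ~~ inc (b - a *+ p.+1).
  have := fin (b - a) (- a); rewrite oppr_eq0 => /(_ a0)[n nn]; exists n.
  by move: nn; rewrite mulNrn mulrS opprD addrA.
case: (ex_minnP exp) => p pout pmin.
have down k : (k <= p)%N -> inc (b - a *+ k).
  case: k => [|k kp]; first by rewrite mulr0n subr0.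
  by apply: contraLR kp => /pmin; rewrite -leqNgt.
pose b0 := b - a *+ p; have bE : b = b0 + a *+ p by rewrite subrK.
case: (ex_minnP (fin b0 a a0)) => m mout mmin.
have up n : (n < m)%N -> inc (b0 + a *+ n).
  by apply: contraLR => /mmin; rewrite -leqNgt.
have pm : (p < m)%N.
  rewrite ltnNge; apply/negP => mp; case/negP: mout.
  rewrite (_ : b0 + a *+ m = b - a *+ (p - m)); first by rewrite down ?leq_subr.
  by rewrite mulrnBr // opprB /b0 addrAC addrA.
have nz n : b0 + a *+ n != 0.
  apply: contra (nab (p%:Z - n%:Z)) => /eqP/(canRL (addrK _)); rewrite sub0r => E.
  by rewrite bE E mulrzBr !pmulrn addrC.
have rootn n : (n < m)%N -> is_root L (b0 + a *+ n).
  by move=> /up /incP li; apply/is_rootE.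
have ninj n k : (b0 + a *+ n == b0 + a *+ k) = (n == k).
  by rewrite (inj_eq (addrI _)) (inj_eq (mulrn_dual_inj a0)).
pose S i := [exists n : 'I_m, lam i == b0 + a *+ n].
have [x [y [ax ay x0 k0]]] := root_vectors ra.
have := trace_coroot (S := S) ax ay k0.
have -> : \sum_(i | S i) ip (lam i) a = \sum_(n < m) ip (b0 + a *+ n) a.
  transitivity (\sum_(n < m) \sum_(i | lam i == b0 + a *+ n) ip (lam i) a).
    rewrite (exchange_big_dep xpredT) //= big_mkcond; apply: eq_bigr => i _.
    case: ifP => [/existsP[n /eqP li]|/negbT no].
      by rewrite (big_pred1 n) // => k; rewrite li ninj eq_sym.
    rewrite big_pred0 // => n; apply/negbTE.
    by apply: contra no => lin; apply/existsP; exists n.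
  apply: eq_bigr => n _; rewrite (eq_bigr (fun _ => ip (b0 + a *+ n) a)).
    by rewrite sumr_const (weight_card1 (rootn n (ltn_ord n))).
  by move=> i /eqP ->.
(* From here on m is the length of the string minus 1. *)
case: m => [//|m] in mout mmin up pm rootn S *.
move=> E; have {E} : \sum_(n < m.+1) ip (b0 + a *+ n) a = 0.
  apply: E => i j /existsP[n /eqP li] lj; apply/existsP.
    have nm : (n.+1 < m.+1)%N.
      rewrite ltn_neqAle ltn_ord andbT; apply: contraNneq mout => <-.
      by apply/incP; exists j; rewrite lj li mulrS addrAC addrA.
    by exists (Ordinal nm); rewrite lj li /= mulrS [a + _]addrC addrA.
  case: n => -[|n] nm in li *.
    case/negP: pout; apply/incP; exists j; rewrite lj li mulr0n addr0 /b0.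
    by rewrite mulrS opprD addrCA addrC.
  exists (Ordinal (ltnW nm)); rewrite lj li /= mulrS [a + _]addrC addrA addrK.
  exact: eqxx.
have -> : \sum_(n < m.+1) ip (b0 + a *+ n) a =
    m.+1%:R * ip b0 a + (\sum_(n < m.+1) n)%:R * ip a a.
  rewrite natr_sum mulr_suml mulr_natl -[X in _ *+ X]card_ord -sumr_const -big_split.
  by apply: eq_bigr => n _; rewrite ipDl -scaler_nat ipZl.
move=> E; have aa := root_nonisotropic ra.
have b0a : 2 * ip b0 a = - (m%:R * ip a a).
  have m0 : m.+1%:R != 0 :> C by rewrite pnatr_eq0.
  have s2 : 2 * (\sum_(n < m.+1) n)%:R = m.+1%:R * m%:R :> C.
    rewrite -!natrM; congr _%:R; elim: (m) => [|k IH]; first by rewrite big_ord1.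
    by rewrite big_ord_recr /= mulnDr IH [(2 * _)%N]mulnC -mulnDr addn2 mulnC.
  apply: (mulfI m0); rewrite mulrCA; move/eqP: E; rewrite addr_eq0 => /eqP ->.
  by rewrite mulrN mulrA s2 mulrN mulrA.
exists (p.*2%:Z - m%:Z); split.
  rewrite pairE bE ipDl -scaler_nat ipZl mulrDr b0a rmorphB /= -!pmulrn.
  by rewrite -muln2 natrM; field.
have -> : b - a *~ (p.*2%:Z - m%:Z) = b0 + a *+ (m - p).
  rewrite mulrzBr -!pmulrn -addnn mulrnDr mulrnBr // bE -addrA; congr (_ + _).
  by rewrite opprB addrCA opprD; congr (_ + _); rewrite addrA subrr add0r.
by apply: rootn; rewrite ltnS leq_subr.
Qed.

(** A string of multiples of a passes through 0, whose weight space is the Cartan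
    subalgebra; there the two claims are immediate. *)
Lemma root_reflection a b : is_root L a -> is_root L b ->
  exists n : int, b (tau L a) = n%:~R /\ is_root L (b - a *~ n).
Proof.
move=> ra rb; have [[n bn]|no] := pselect (exists n : int, b = a *~ n).
  exists (2 * n); split; last first.
    rewrite (_ : b - _ = - b); first exact: opp_root.
    by rewrite bn -mulrzBr -mulrNz; congr (_ *~ _); ring.
  rewrite pairE bn -scaler_int ipZl intrM; field.
  exact: root_nonisotropic.
by apply: root_string => // n; apply/eqP => E; apply: no; exists n.
Qed.

Lemma ip0l v : ip 0 v = 0.
Proof. by rewrite /ip zero_lfunE. Qed.

Lemma ip_self v : ip v v = \sum_i ip (lam i) v ^+ 2.
Proof. by rewrite ip_sum; apply: eq_bigr => i _; rewrite expr2. Qed.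

(** A sum of squares of real numbers. *)
Lemma ip_gt0 v :
  (forall a, is_root L a -> ip a v \is Num.real) -> v != 0 -> 0 < ip v v.
Proof.
move=> vr v0; have sq0 i : 0 <= ip (lam i) v ^+ 2.
  rewrite real_exprn_even_ge0 //; have [->|li0] := eqVneq (lam i) 0.
    by rewrite ip0l real0.
  exact/vr/is_root_lam.
rewrite lt_neqAle eq_sym ip_self sumr_ge0 // andbT.
apply: contra v0 => /eqP s0; apply/eqP/ip_weights_eq0 => i.
apply/eqP; rewrite -sqrf_eq0; apply/eqP; move: i isT.
exact: psumr_eq0P.
Qed.

(** The products of a with the weights are integral multiples of half its norm, so
    the norm is its own square times a sum q of rational squares. *)
Lemma root_norm_gt0 a : is_root L a -> 0 < ip a a.
Proof.
move=> ra; have aa := root_nonisotropic ra.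
pose q := \sum_i (lam i (tau L a) / 2 : C) ^+ 2.
have E : ip a a = ip a a ^+ 2 * q.
  rewrite {1}ip_self mulr_sumr; apply: eq_bigr => i _.
  by rewrite pairE; field.
have qV : (ip a a)^-1 = q.
  by apply: mulr1_eq; apply: (mulfI aa); rewrite mulr1 [RHS]E expr2 mulrA.
have q0 : 0 <= q.
  apply: sumr_ge0 => i _; rewrite real_exprn_even_ge0 // rpred_div ?realn //.
  have [->|/is_root_lam li] := eqVneq (lam i) 0; first by rewrite zero_lfunE real0.
  by have [n [-> _]] := root_reflection ra li; rewrite realz.
by rewrite lt_neqAle eq_sym aa -invr_ge0 qV.
Qed.

(** The root spaces of the roots in P, together with their coroots, span an
    ideal: the sum of a root in P and any other root cannot be a root outside P.
    The ideal is proper if some root b is not in P, because a vector of weight -b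
    is orthogonal to it. *)
Lemma roots_irreducible (P : dual h -> Prop) :
    (forall a b, is_root L a -> is_root L b -> P a -> ~ P b -> ip a b = 0) ->
    (exists2 a, is_root L a & P a) ->
  forall b, is_root L b -> P b.
Proof.
move=> Port [a0 ra0 Pa0] b rb; apply: contrapT => nPb.
pose T i := (lam i != 0) && `[< P (lam i) >].
have TP i : T i -> is_root L (lam i) /\ P (lam i).
  by case/andP=> /is_root_lam ? /asboolP.
pose evec (i : 'I_(\dim {:g})) : g := e`_i.
pose cvec i : g := vsval (coroot_H L (lam i)).
pose X := map evec (enum T) ++ map cvec (enum T).
have eX (i : 'I_(\dim {:g})) : T i -> e`_i \in <<X>>%VS.
  move=> Ti; apply: memv_span; rewrite mem_cat; apply/orP; left.
  by apply/mapP; exists i => //; rewrite mem_enum.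
have HX (i : 'I_(\dim {:g})) : T i -> vsval (coroot_H L (lam i)) \in <<X>>%VS.
  move=> Ti; apply: memv_span; rewrite mem_cat; apply/orP; right.
  by apply/mapP; exists i => //; rewrite mem_enum.
have memX y : y \in X ->
    exists2 i, T i & y = e`_i \/ y = vsval (coroot_H L (lam i)).
  rewrite mem_cat => /orP[]yX.
    have [i Ti ->] := elimTF (@mapP _ _ evec _ y) yX.
    by rewrite mem_enum in Ti; exists i => //; left.
  have [i Ti ->] := elimTF (@mapP _ _ cvec _ y) yX.
  by rewrite mem_enum in Ti; exists i => //; right.
have idealX (j : 'I_(\dim {:g})) y : y \in X -> L e`_j y \in <<X>>%VS.
  move=> /memX[i Ti [->|->]]; last first.
    rewrite brC e_weight rpredN; have [->|j0] := eqVneq (lam j) 0.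
      by rewrite zero_lfunE scale0r mem0v.
    have [Pj|Pj] := pselect (P (lam j)).
      by rewrite memvZ // eX // /T j0; apply/asboolP.
    have [ri Pi] := TP _ Ti.
    rewrite -[X in X *: _]/(ip _ _) ipC (Port _ _ ri (is_root_lam j0) Pi Pj).
    by rewrite scale0r mem0v.
  have [ri Pi] := TP _ Ti.
  have [j0|j0] := eqVneq (lam j) 0.
    have ej : e`_j \in h by apply/(has_weight0 cartan_h); rewrite -j0.
    by rewrite -[e`_j]/(vsval (Subvs ej)) e_weight memvZ // eX.
  have sw := has_weight_br (e_weight j) (e_weight i).
  have [s0|s0] := eqVneq (lam j + lam i) 0.
    have wj : has_weight L (- lam i) e`_j.
      by move/eqP: s0; rewrite addr_eq0 => /eqP <-.
    by rewrite brC (br_opp (e_weight i) wj) rpredN memvZ // HX.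
  have [->|br0] := eqVneq (L e`_j e`_i) 0; first exact: mem0v.
  have rs : is_root L (lam j + lam i).
    by apply/is_rootE; split=> //; exact: weight_occurs sw br0.
  have [Ps|Ps] := pselect (P (lam j + lam i)).
    rewrite (weight_sum sw) rpred_sum // => k /eqP lk.
    by rewrite memvZ // eX // /T lk s0; apply/asboolP.
  have is0 := Port _ _ ri rs Pi Ps.
  have [Pj|Pj] := pselect (P (lam j)).
    have js0 := Port _ _ (is_root_lam j0) rs Pj Ps.
    by case/eqP: (root_nonisotropic rs); rewrite ipDl js0 is0 addr0.
  case/eqP: (root_nonisotropic ri); move: is0.
  by rewrite ipC ipDl (ipC (lam j)) (Port _ _ ri (is_root_lam j0) Pi Pj) add0r.
case: simple_g => _ /(_ <<X>>%VS)[].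
- move=> x y; rewrite (coord_basis eB (memvf x)) br_suml => yX.
  apply: rpred_sum => j _; rewrite brZl memvZ // -adE.
  have : ad L e`_j y \in (ad L e`_j @: <<X>>)%VS by exact: memv_img.
  rewrite limg_span; apply/subvP/span_subvP => _ /mapP[z zX ->].
  by rewrite adE idealX.
- move=> X0; have [_ [i li]] := (is_rootE a0).1 ra0.
  have := e_neq0 i; rewrite -memv0 -X0 eX // /T li; case: ra0 => -> _.
  exact/asboolP.
have [b0 [j lj]] := (is_rootE b).1 rb.
have [m lm k0] := opp_weight (e_weight j) (e_neq0 j).
move=> XT; case/negP: k0; rewrite killingC.
have : (<<X>> <= lker (linfun (killing L e`_m : g -> C^o)))%VS.
  apply/span_subvP => y; rewrite memv_ker lfunE /= => /memX[i /TP[ri Pi] [->|->]].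
    rewrite (killing_weight (e_weight m) (e_weight i)) // lm lj addrC subr_eq0.
    by apply: contra_not_neq nPb => <-.
  rewrite (killing_weight (b := 0) (e_weight m)) //.
    by apply/(has_weight0 cartan_h); exact: subvsP.
  by rewrite addr0 lm lj oppr_eq0.
by rewrite XT => /subvP/(_ _ (memvf e`_j)); rewrite memv_ker lfunE.
Qed.

End RootSpaces.

(** * The root system *)

(** Only the coroots of simple roots are known to exist beforehand, from the
    fundamental weights: the default value of [coroot_H] would make them 0.
    Since the simple roots form a basis, the Killing form then represents every
    linear form on the Cartan subalgebra. *)
Lemma corootP (C : numClosedFieldType) (g : vectType C) (L : lie_bracket g)
    (h : {vspace g}) (l : nat) (alpha omega : 'I_l.+1 -> dual h) :
    basis_of fullv (mktuple alpha) -> fundamental_weights L alpha omega ->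
  forall (v : dual h) H, killing_h L H (coroot_H L v) = v H.
Proof.
move=> alphaB fund v.
have simple_ex i : exists K, forall H, killing_h L H K = alpha i H.
  apply: contrapT => no; have := fund i i; rewrite /tau /coroot_H xgetPN.
    by rewrite scaler0 linear0 eqxx => /esym/eqP; rewrite oner_eq0.
  by move=> K HK; apply: no; exists K.
have [K KP] := choice simple_ex.
apply: (@xgetPex _ 0 [set K | forall H, killing_h L H K = v H]).
exists (\sum_i coord (mktuple alpha) i v *: K i) => H /=.
rewrite [in RHS](coord_basis alphaB (memvf v)) /killing_h !linear_sum /=.
rewrite sum_lfunE; apply: eq_bigr => i _.
by rewrite !linearZ scale_lfunE nth_mktuple -KP.
Qed.

(** The axioms of an irreducible reduced crystallographic root system. The field is
    not totally ordered, so positivity of the form is stated for the vectors which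
    have real products with all roots: these make up the real span of the roots. *)
Record root_datum (C : numClosedFieldType) (g : vectType C) (L : lie_bracket g)
    (h : {vspace g}) : Prop := RootDatum {
  rd_ipC : forall a b : dual h, ip L a b = ip L b a;
  rd_pair : forall v a : dual h, v (tau L a) = 2 * ip L v a / ip L a a;
  rd_norm2 : forall a : dual h, norm2 L a = ip L a a;
  rd_norm_gt0 : forall a : dual h, is_root L a -> 0 < ip L a a;
  rd_pos : forall v : dual h,
    (forall a, is_root L a -> ip L a v \is Num.real) -> v != 0 -> 0 < ip L v v;
  rd_refl : forall a b : dual h, is_root L a -> is_root L b ->
    exists n : int, b (tau L a) = n%:~R /\ is_root L (b - a *~ n);
  rd_double : forall a : dual h, is_root L a -> ~ is_root L (a *+ 2);
  rd_irr : forall P : dual h -> Prop,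
    (forall a b, is_root L a -> is_root L b -> P a -> ~ P b -> ip L a b = 0) ->
    (exists2 a, is_root L a & P a) -> forall b, is_root L b -> P b;
  rd_finite : exists s : seq (dual h), forall a, is_root L a -> a \in s
}.

Theorem lie_root_datum (C : numClosedFieldType) (g : vectType C) (L : lie_bracket g)
    (h : {vspace g}) : lie_simple L -> cartan_subalgebra L h ->
    (forall (v : dual h) H, killing_h L H (coroot_H L v) = v H) ->
  root_datum L h.
Proof.
move=> sg ch cP; have [e [lam [eB ew]]] := eigenbasis ch.
split.
- exact: ipC cP.
- exact: pairE cP.
- exact: norm2E cP.
- move=> a ra; exact: (root_norm_gt0 sg ch cP eB ew ra).
- move=> v vr v0; exact: (ip_gt0 cP eB ew vr v0).
- move=> a b ra rb; exact: (root_reflection sg ch cP eB ew ra rb).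
- move=> a ra; exact: (double_not_root sg ch cP eB ew ra).
- move=> P PP Pex b; exact: (roots_irreducible sg ch cP eB ew PP Pex).
- exists (codom lam) => a /(is_rootE eB ew)[_ [i <-]]; exact: codom_f.
Qed.

(** * Reflections, the Weyl group and even roots *)

Section EvenRoots.
Variables (C : numClosedFieldType) (g : vectType C) (L : lie_bracket g).
Variable h : {vspace g}.
Hypothesis rd : root_datum L h.

Local Notation ip := (@ip C g L h).
Local Notation s := (@reflection C g L h).
Implicit Types (a b c u v : dual h) (w : dual h -> dual h).

Lemma ipDr a b c : ip c (a + b) = ip c a + ip c b.
Proof. by rewrite !(rd_ipC rd c) ipDl. Qed.

Lemma ipZr k a c : ip c (k *: a) = k * ip c a.
Proof. by rewrite !(rd_ipC rd c) ipZl. Qed.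

Lemma ipNl a c : ip (- a) c = - ip a c.
Proof. by rewrite -scaleN1r ipZl mulN1r. Qed.

Lemma ipNr a c : ip c (- a) = - ip c a.
Proof. by rewrite -scaleN1r ipZr mulN1r. Qed.

Definition ipE := (ipDl, ipDr, ipZl, ipZr, ipNl, ipNr).

Lemma root_norm_neq0 a : is_root L a -> ip a a != 0.
Proof. by move/(rd_norm_gt0 rd)/lt0r_neq0. Qed.

Lemma ip_pair a b : is_root L a -> ip b a = b (tau L a) * ip a a / 2.
Proof. by move/root_norm_neq0 => a0; rewrite (rd_pair rd); field. Qed.

Lemma tau_self a : is_root L a -> a (tau L a) = 2 :> C.
Proof. by move/root_norm_neq0 => a0; rewrite (rd_pair rd); field. Qed.

Lemma ip_root_real a b : is_root L a -> is_root L b -> ip a b \is Num.real.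
Proof.
move=> ra rb; have [n [E _]] := rd_refl rd rb ra.
rewrite (ip_pair _ rb) E rpred_div ?realn // rpredM ?realz //.
exact/gtr0_real/(rd_norm_gt0 rd).
Qed.

Lemma reflection_linear a : linear (s a).
Proof.
move=> k u v; rewrite /reflection add_lfunE scale_lfunE scalerBr scalerDl scalerA.
by rewrite opprD addrACA.
Qed.

Lemma reflection_root a b : is_root L a -> is_root L b -> is_root L (s a b).
Proof.
move=> ra rb; have [n [E r]] := rd_refl rd ra rb.
by rewrite /reflection E scaler_int.
Qed.

Lemma reflection_self a : is_root L a -> s a a = - a.
Proof.
move=> ra; rewrite /reflection tau_self // scaler_nat mulr2n opprD addrA.
by rewrite subrr sub0r.
Qed.

Lemma reflection_orth a v : ip v a = 0 -> s a v = v.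
Proof. by move=> E; rewrite /reflection (rd_pair rd) E mulr0 mul0r scale0r subr0. Qed.

Lemma reflectionN a : s (- a) = s a.
Proof.
apply/funext => v; rewrite /reflection !(rd_pair rd) !ipE !opprK scalerN -scaleNr.
by rewrite mulrN mulNr opprK.
Qed.

Lemma root_opp a : is_root L a -> is_root L (- a).
Proof. by move=> ra; rewrite -reflection_self //; exact: reflection_root. Qed.

Lemma reflectionK a : is_root L a -> involutive (s a).
Proof.
move=> ra v; rewrite {1}/reflection.
have -> : s a v (tau L a) = - (v (tau L a) : C).
  rewrite /reflection add_lfunE opp_lfunE scale_lfunE tau_self // -[_ *: _]/(_ * _).
  by ring.
by rewrite scaleNr opprK subrK.
Qed.

Lemma reflection_ip a u v : is_root L a -> ip (s a u) (s a v) = ip u v.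
Proof.
move=> /root_norm_neq0 a0; rewrite /reflection !(rd_pair rd) !ipE (rd_ipC rd a v).
by field.
Qed.

Lemma weyl_linear w : weyl L w -> linear w.
Proof.
by elim=> [|a w' ra _ IH] k u v //=; rewrite IH reflection_linear.
Qed.

Lemma weylZ w k v : weyl L w -> w (k *: v) = k *: w v.
Proof.
move=> ww; have := weyl_linear ww; move=> wl; have w0 : w 0 = 0.
  by have := wl (-1) 0 0; rewrite scaler0 addr0 scaleN1r addNr.
by have := wl k v 0; rewrite w0 !addr0.
Qed.

Lemma weylD w u v : weyl L w -> w (u + v) = w u + w v.
Proof. by move=> ww; have := weyl_linear ww 1 u v; rewrite !scale1r. Qed.

Lemma weylN w v : weyl L w -> w (- v) = - w v.
Proof. by move=> ww; rewrite -scaleN1r weylZ // scaleN1r. Qed.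

Lemma weyl_root w a : weyl L w -> is_root L a -> is_root L (w a).
Proof. by elim=> [|b w' rb _ IH] //= ra; apply: reflection_root => //; exact: IH. Qed.

Lemma weyl_ip w u v : weyl L w -> ip (w u) (w v) = ip u v.
Proof. by elim=> [|b w' rb _ IH] //=; rewrite reflection_ip. Qed.

Lemma weyl_reflection a : is_root L a -> weyl L (s a).
Proof. by move=> ra; exact: (weylM ra (weyl1 L h)). Qed.

Lemma weyl_comp w w' : weyl L w -> weyl L w' -> weyl L (w \o w').
Proof. by elim=> [|b w'' rb _ IH] // ww'; exact: weylM (IH ww'). Qed.

Lemma weyl_inv w : weyl L w -> exists2 w', weyl L w' & cancel w w' /\ cancel w' w.
Proof.
elim=> [|a w1 ra _ [w' ww' [K K']]]; first by exists id => //; exact: weyl1.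
exists (w' \o s a); first exact: weyl_comp (weyl_reflection ra).
by split=> v /=; rewrite ?reflectionK ?K // K' reflectionK.
Qed.

Lemma weyl_orbit_refl v : weyl_orbit L v v.
Proof. by exists id => //; exact: weyl1. Qed.

Lemma weyl_orbitE w v : weyl L w -> weyl_orbit L (w v) = weyl_orbit L v.
Proof.
move=> ww; have [w' ww' [K _]] := weyl_inv ww.
apply/seteqP; split=> _ [w1 ww1 ->].
  by exists (w1 \o w) => //; exact: weyl_comp.
by exists (w1 \o w'); [exact: weyl_comp | rewrite /= K].
Qed.

Variable beta : dual h.
Hypothesis beta_root : is_root L beta.
Hypothesis beta_even :
  forall c, is_root L c -> exists m : int, beta (tau L c) = (2 * m)%:~R.

Local Notation O := (weyl_orbit L beta).
Local Notation N := (ip beta beta).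

Lemma orbit_root b : O b -> is_root L b.
Proof. by case=> w ww ->; exact: weyl_root. Qed.

Lemma orbit_norm b : O b -> ip b b = N.
Proof. by case=> w ww ->; exact: weyl_ip. Qed.

Lemma orbit_reflection a b : is_root L a -> O b -> O (s a b).
Proof. by move=> ra [w ww ->]; exists (s a \o w) => //; exact: weylM. Qed.

Lemma orbit_opp b : O b -> O (- b).
Proof.
move=> Ob; have rb := orbit_root Ob.
by rewrite -reflection_self //; exact: orbit_reflection.
Qed.

Lemma orbit_even b c : O b -> is_root L c ->
  exists m : int, b (tau L c) = (2 * m)%:~R.
Proof.
case=> w ww -> rc; have [w' ww' [_ K]] := weyl_inv ww.
have [m E] := beta_even (weyl_root ww' rc); exists m.
by rewrite -E !(rd_pair rd) -{1 2 3}[c]K !weyl_ip.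
Qed.

Lemma orbit_norm_neq0 : N != 0.
Proof. exact: root_norm_neq0. Qed.

(** The product of two members is an integral multiple m of their common norm N,
    so the norm of b - m b' is N (1 - m^2), which cannot be negative. *)
Lemma orbit_trichotomy b b' : O b -> O b' -> [\/ b' = b, b' = - b | ip b b' = 0].
Proof.
move=> Ob Ob'; have [rb rb'] := (orbit_root Ob, orbit_root Ob').
have [m E] := orbit_even Ob rb'; have N0 := rd_norm_gt0 rd beta_root.
have Eip : ip b b' = m%:~R * N.
  by rewrite (ip_pair _ rb') E orbit_norm // intrM; field.
pose v := b - m%:~R *: b'.
have vv : ip v v = N * (1 - m ^+ 2)%:~R.
  rewrite /v !ipE (rd_ipC rd b') Eip (orbit_norm Ob) (orbit_norm Ob').
  by rewrite rmorphB rmorphXn /=; ring.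
have [v0|v0] := eqVneq v 0; last first.
  have : 0 < ip v v.
    apply: (rd_pos rd) v0 => a ra; rewrite /v !ipE.
    by rewrite rpredB ?rpredM ?ip_root_real // realz.
  rewrite vv pmulr_rgt0 // ltr0z => m1.
  have m0 : m = 0 by nia.
  by rewrite m0 mul0r in Eip; constructor 3.
have bE : b = m%:~R *: b' by apply/eqP; rewrite -subr_eq0 -/v v0.
have /eqP : N * (1 - m ^+ 2)%:~R = 0 by rewrite -vv v0 ip0l.
rewrite mulf_eq0 (negPf orbit_norm_neq0) /= intr_eq0 subr_eq0 eq_sym sqrf_eq1.
case/orP => /eqP mE; rewrite mE in bE; first by constructor 1; rewrite bE scale1r.
by constructor 2; rewrite bE scaleN1r opprK.
Qed.

Lemma half_half (v : dual h) : (2 : C)^-1 *: (v *+ 2) = v.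
Proof. by rewrite -scaler_nat scalerA mulVf ?scale1r // pnatr_eq0. Qed.

Lemma divisor_bound (m k n : int) : m * k = n -> 0 < n -> - n <= m <= n.
Proof.
move=> mk n0; have [k0|k0] := lerP k 0; last by apply/andP; split; nia.
by have [k1|k1] := lerP k (-1); [apply/andP; split; nia | nia].
Qed.

(** Let b pair with the coroot of c to 2m. The mirror image b - 2m c is in the orbit,
    so it is -b or orthogonal to b. In the first case b = m c, and integrality of
    the opposite pairing and reducedness leave m = 1 or -1. In the second case
    the norm of b is 2 m^2 times that of c, so the opposite pairing is 1/m. *)
Lemma root_not_orthogonal b c : O b -> is_root L c -> ip b c != 0 ->
  [\/ c = b, c = - b | ip b (s c b) = 0 /\
    (c = 2^-1 *: (b - s c b) \/ c = 2^-1 *: (s c b - b))].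
Proof.
move=> Ob rc bc; have rb := orbit_root Ob.
have [m E] := orbit_even Ob rc; have N0 := orbit_norm_neq0.
have c0 := root_norm_neq0 rc; have b0 := root_norm_neq0 rb.
have Eip : ip b c = m%:~R * ip c c.
  by rewrite (ip_pair _ rc) E intrM; field.
have m0 : m%:~R != 0 :> C.
  by apply: contraNneq bc => m0; rewrite Eip m0 mul0r.
have mz : m != 0 by rewrite -(intr_eq0 C).
have [k [Ek _]] := rd_refl rd rb rc.
have sb : s c b = b - (2 * m)%:~R *: c by rewrite /reflection E.
have Ekm : k%:~R = 2 * m%:~R * ip c c / ip b b.
  by rewrite -Ek (rd_pair rd) (rd_ipC rd) Eip; field.
have Osb := orbit_reflection rc Ob.
case: (orbit_trichotomy Ob Osb).
- move/eqP; rewrite sb -subr_eq0 addrC addKr oppr_eq0 scaler_eq0 intrM mulf_eq0.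
  by rewrite pnatr_eq0 (negPf m0) /=; case: rc => /negPf ->.
- move=> sbN; have bE : b = m%:~R *: c.
    have b2 : b *+ 2 = (2 * m)%:~R *: c.
      by apply/eqP; rewrite mulr2n -subr_eq0 -addrA -sb sbN subrr.
    by rewrite -[LHS]half_half b2 scalerA intrM mulKf ?pnatr_eq0.
  have : (m * k)%:~R = 2%:~R :> C.
    by rewrite intrM Ekm bE !ipE; field; rewrite c0 m0.
  move/eqP; rewrite eqr_int => /eqP mk.
  have /andP[m1 m2] : - 2 <= m <= 2 by exact: divisor_bound mk _.
  have : m = 1 \/ m = -1 \/ m = 2 \/ m = -2 by lia.
  case=> [|[|[|]]] mE; rewrite mE in bE.
  + by constructor 1; rewrite bE scale1r.
  + by constructor 2; rewrite bE scaleN1r opprK.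
  + by case: (rd_double rd rc); rewrite -scaler_nat -bE.
  + case: (rd_double rd (root_opp rc)); rewrite -scaler_nat scalerN -scaleNr.
    by rewrite -[- 2%:R]/((-2)%:~R : C) -bE.
move=> orth; constructor 3; split=> //.
have bb : ip b b = 2 * m%:~R ^+ 2 * ip c c.
  move/eqP: orth; rewrite sb !ipE Eip subr_eq0 => /eqP ->.
  by rewrite intrM; ring.
have : (m * k)%:~R = 1%:~R :> C.
  by rewrite intrM Ekm bb; field; rewrite c0 m0.
move/eqP; rewrite eqr_int => /eqP mk.
have /andP[m1 m2] : - 1 <= m <= 1 by exact: divisor_bound mk _.
have [mE|mE] : m = 1 \/ m = -1 by lia.
  by left; rewrite sb mE opprB addrC subrK scaler_nat half_half.
by right; rewrite sb mE addrAC subrr sub0r -scaleNr -rmorphN scaler_nat half_half.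
Qed.

(** The roots not orthogonal to the orbit are, up to a factor, members of the orbit
    or differences of two members, so they are orthogonal to all other roots. *)
Lemma not_orthogonal_to_orbit c : is_root L c -> exists2 b, O b & ip b c != 0.
Proof.
move=> rc; apply: (rd_irr rd (P := fun c => exists2 b, O b & ip b c != 0)) => //.
  move=> {rc}c c' rc rc' [b Ob bc] no.
  have orth b' : O b' -> ip b' c' = 0.
    by move=> Ob'; apply/eqP; apply: contrapT => /negP ne; apply: no; exists b'.
  have Osb := orbit_reflection rc Ob.
  have [o1 o2] := (orth _ Ob, orth _ Osb).
  case: (root_not_orthogonal Ob rc bc) => [->|->|[_ []] E] //.
  - by rewrite ipNl o1 oppr0.
  - by rewrite E ipZl ipDl ipNl o1 o2 oppr0 addr0 mulr0.
  - by rewrite E ipZl ipDl ipNl o1 o2 oppr0 addr0 mulr0.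
by exists beta => //; exists beta; [exact: weyl_orbit_refl | exact: orbit_norm_neq0].
Qed.

Lemma root_shape c : is_root L c ->
  O c \/ exists b b', [/\ O b, O b', ip b b' = 0 & c = 2^-1 *: (b - b')].
Proof.
move=> rc; have [b Ob bc] := not_orthogonal_to_orbit rc.
have Osb := orbit_reflection rc Ob.
case: (root_not_orthogonal Ob rc bc) => [->|->|[orth []] E].
- by left.
- by left; exact: orbit_opp.
- by right; exists b, (s c b).
- by right; exists (s c b), b; split=> //; rewrite (rd_ipC rd).
Qed.

(** Reflect in b', which changes the sign of b' and fixes b. *)
Lemma half_sum_root b b' : O b -> O b' -> ip b b' = 0 ->
  is_root L (2^-1 *: (b - b')) -> is_root L (2^-1 *: (b + b')).
Proof.
move=> Ob Ob' orth r; have rb' := orbit_root Ob'.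
have := reflection_root rb' r.
rewrite /reflection (rd_pair rd) !ipE orth (orbit_norm Ob').
rewrite (_ : _ / N = -1); last by field; exact: orbit_norm_neq0.
congr is_root; rewrite scaleN1r opprK -[X in _ + X]half_half -scalerDr.
by rewrite mulr2n addrA subrK.
Qed.

Let joined b := [\/ b = beta, b = - beta | is_root L (2^-1 *: (beta - b))].

Let joined_step b c : O b -> is_root L c -> joined b -> joined (s c b).
Proof.
move=> Ob rc jb; have Obeta := weyl_orbit_refl beta.
have Osb := orbit_reflection rc Ob.
have [bc|bc] := eqVneq (ip b c) 0; first by rewrite reflection_orth.
have jN : joined (- b).
  case: (orbit_trichotomy Obeta Ob) => [->|->|orth].
  - by constructor 2.
  - by constructor 1; rewrite opprK.
  case: jb => [->|->|r]; [by constructor 2|by constructor 1; rewrite opprK|].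
  by constructor 3; rewrite opprK; exact: half_sum_root.
case: (root_not_orthogonal Ob rc bc) => [->|->|[orth cE]].
- by rewrite reflection_self //; exact: orbit_root Ob.
- by rewrite reflectionN reflection_self //; exact: orbit_root Ob.
have r : is_root L (2^-1 *: (b - s c b)).
  by case: cE => E; [rewrite -E | rewrite -opprB scalerN -E; exact: root_opp].
move: (s c b) Osb orth r {cE} => b' Osb orth r.
case: (orbit_trichotomy Obeta Osb) => [->|->|ort']; [by constructor 1|by constructor 2|].
(* Now beta, b and b' are orthogonal unless b is beta or -beta; the reflection in
   (b - b')/2 maps (beta - b)/2 to (beta - b')/2. *)
constructor 3; case: (orbit_trichotomy Obeta Ob) => [bE|bE|ort].
- by rewrite -bE.
- by rewrite -[beta]opprK -bE -opprD scalerN; apply/root_opp/half_sum_root.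
case: jb => [jb|jb|r'].
- by rewrite -jb.
- by rewrite -[beta]opprK -jb -opprD scalerN; apply/root_opp/half_sum_root.
have := reflection_root r r'.
rewrite {1}/reflection (rd_pair rd) !ipE ort ort' orth (rd_ipC rd _ b) orth.
rewrite (orbit_norm Ob) (orbit_norm Osb).
rewrite (_ : _ / _ = -1); last first.
  by field; rewrite opprK -mulr2n mulrn_eq0 negb_or orbit_norm_neq0.
by rewrite scaleN1r opprK -scalerDr addrA subrK.
Qed.

(** The members whose half difference with beta is a root, together with beta and
    -beta, are stable under all reflections, so they fill the orbit. *)
Lemma half_difference_root b b' : O b -> O b' -> ip b b' = 0 ->
  is_root L (2^-1 *: (b - b')).
Proof.
case=> w ww -> Ob' orth; have [w' ww' [K K']] := weyl_inv ww.
have J w1 : weyl L w1 -> joined (w1 beta).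
  elim=> [|a w2 ra ww2 IH] /=; first by constructor 1.
  by apply: joined_step => //; exists w2.
have [w1 ww1 E1] : O (w' b').
  by case: Ob' => w2 ww2 ->; exists (w' \o w2) => //; exact: weyl_comp.
have ort1 : ip beta (w1 beta) = 0 by rewrite -E1 -(weyl_ip _ _ ww) K'.
have N0 := orbit_norm_neq0.
case: (J w1 ww1) => [E|E|r].
- by move/eqP: ort1; rewrite E (negPf N0).
- by move/eqP: ort1; rewrite E ipNr oppr_eq0 (negPf N0).
by have := weyl_root ww r; rewrite weylZ // weylD // weylN // -E1 K'.
Qed.

End EvenRoots.

(** * Heights and the orthogonal frame *)

Section Frame.
Variables (C : numClosedFieldType) (g : vectType C) (L : lie_bracket g).
Variable h : {vspace g}.
Hypothesis rd : root_datum L h.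
Variables (l : nat) (alpha : 'I_l.+1 -> dual h).
Hypothesis base_alpha : is_base L alpha.

Local Notation ip := (@ip C g L h).
Implicit Types a b c u v : dual h.

Definition height v : C := \sum_i coord (mktuple alpha) i v.
Local Notation ht := height.

Let alphaB : basis_of fullv (mktuple alpha).
Proof. by case: base_alpha. Qed.

Lemma heightD u v : ht (u + v) = ht u + ht v.
Proof. by rewrite /ht -big_split; apply: eq_bigr => i _; rewrite linearD. Qed.

Lemma heightZ k v : ht (k *: v) = k * ht v.
Proof. by rewrite /ht mulr_sumr; apply: eq_bigr => i _; rewrite linearZ. Qed.

Lemma heightN v : ht (- v) = - ht v.
Proof. by rewrite -scaleN1r heightZ mulN1r. Qed.

Lemma height_nonneg_comb (c : 'I_l.+1 -> nat) :
  ht (\sum_i alpha i *+ c i) = (\sum_i c i)%:R.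
Proof.
rewrite /ht natr_sum; apply: eq_bigr => i _.
rewrite (eq_bigr (fun j : 'I_l.+1 => (c j)%:R *: (mktuple alpha)`_j)) => [|j _].
  by rewrite coord_sum_free // (basis_free alphaB).
by rewrite nth_mktuple scaler_nat.
Qed.

Lemma height_root b : is_root L b ->
  (nonneg_comb alpha b /\ exists n, ht b = n.+1%:R) \/
  (nonneg_comb alpha (- b) /\ exists n, ht b = - n.+1%:R).
Proof.
move=> rb; have key c : c != 0 -> nonneg_comb alpha c -> exists n, ht c = n.+1%:R.
  move=> c0 [k cE]; have := height_nonneg_comb k; rewrite -cE.
  case E : (\sum_i k i)%N => [|n] Ht; last by exists n.
  case/eqP: c0; rewrite cE big1 // => i _.
  by move/eqP: E; rewrite sum_nat_eq0 => /forallP/(_ i)/eqP ->.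
have b0 : b != 0 by case: rb.
case: base_alpha => _ _ /(_ b rb) [nb|nb]; [left|right]; split=> //.
  exact: key.
have [|n Hn] := key _ _ nb; first by rewrite oppr_eq0.
by exists n; rewrite -Hn heightN opprK.
Qed.

Lemma height_root_real b : is_root L b -> ht b \is Num.real.
Proof. by case/height_root => -[_ [n ->]]; rewrite ?rpredN realn. Qed.

Lemma height_root_neq0 b : is_root L b -> ht b != 0.
Proof. by case/height_root => -[_ [n ->]]; rewrite ?oppr_eq0 pnatr_eq0. Qed.

Lemma height_gt0_nat b : is_root L b -> 0 < ht b -> exists n, ht b = n.+1%:R.
Proof.
by case/height_root => [[]//|[_ [n ->]]]; rewrite oppr_gt0 ltrn0.
Qed.

Lemma height_gt0P b : is_root L b -> 0 < ht b \/ 0 < ht (- b).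
Proof.
by case/height_root => -[_ [n E]]; rewrite heightN E ?opprK ltr0n; [left|right].
Qed.

Lemma dim_dual : \dim {: dual h} = l.+1.
Proof. by rewrite -(size_basis alphaB). Qed.

(** Such a v is orthogonal to everything, itself included, and positivity applies
    to it because its products with the roots are 0. *)
Lemma ip_nondeg v : (forall i, ip v (alpha i) = 0) -> v = 0.
Proof.
move=> va; have vu u : ip v u = 0.
  rewrite (rd_ipC rd) (coord_basis alphaB (memvf u)).
  elim/big_ind: _ => [|x y Hx Hy|i _]; first exact: ip0l.
    by rewrite ipDl Hx Hy addr0.
  by rewrite ipZl nth_mktuple (rd_ipC rd) va mulr0.
apply/eqP; apply: contraT => v0.
have := rd_pos rd (v := v) _ v0; rewrite vu ltxx; apply=> a _.
by rewrite (rd_ipC rd) vu real0.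
Qed.

Variable beta : dual h.
Hypothesis beta_root : is_root L beta.
Hypothesis beta_even :
  forall c, is_root L c -> exists m : int, beta (tau L c) = (2 * m)%:~R.

Local Notation O := (weyl_orbit L beta).
Local Notation N := (ip beta beta).

(** The members of positive height, sorted by decreasing height, are the vectors
    2 e_1, ..., 2 e_n of the usual model. They are orthogonal and span all roots,
    so there are as many as simple roots; no two have the same height, because
    half of their difference is a root, and roots have nonzero height. *)
Lemma orthogonal_frame : exists E : 'I_l.+1 -> dual h,
  [/\ forall i, O (E i), forall i, 0 < ht (E i),
      forall i j : 'I_l.+1, (i < j)%N -> ht (E j) < ht (E i)
    & forall b, O b -> exists i, b = E i \/ b = - E i].
Proof.
have Or b : O b -> is_root L b by exact: orbit_root.
have [s0 s0P] := rd_finite rd.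
pose p b := `[< O b >] && (0 < ht b).
have pP b : p b -> O b /\ 0 < ht b by case/andP=> /asboolP.
pose lt := fun b b' => ht b' <= ht b.
pose X := sort lt [seq b <- undup s0 | p b].
have memX b : (b \in X) = p b.
  rewrite mem_sort mem_filter mem_undup; case pb : (p b) => //=.
  by apply: s0P; apply: Or; case: (pP _ pb).
have Xu : uniq X by rewrite sort_uniq filter_uniq // undup_uniq.
have Xs : sorted lt X.
  apply: (sort_sorted_in (P := p)); last exact: filter_all.
  move=> b b' /pP[/Or/height_root_real hb _] /pP[/Or/height_root_real hb' _].
  exact: real_leVge.
have nthX i : (i < size X)%N -> O X`_i /\ 0 < ht X`_i.
  by move=> iX; apply: pP; rewrite -memX mem_nth.
have orthX i j : (i < size X)%N -> (j < size X)%N -> i != j -> ip X`_i X`_j = 0.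
  move=> iX jX ij; have [[Oi hi] [Oj hj]] := (nthX i iX, nthX j jX).
  case: (orbit_trichotomy rd beta_root beta_even Oi Oj) => // E.
    by move/eqP: E; rewrite eq_sym nth_uniq // (negPf ij).
  by move: hj; rewrite E heightN oppr_gt0 => /(lt_trans hi); rewrite ltxx.
have incX b : O b -> exists2 i, (i < size X)%N & b = X`_i \/ b = - X`_i.
  move=> Ob; have ONb := orbit_opp rd beta_root Ob.
  case: (height_gt0P (Or _ Ob)) => hb; [exists (index b X)|exists (index (- b) X)];
    rewrite ?index_mem ?nth_index ?memX /p ?hb ?andbT ?opprK; auto; exact/asboolP.
have Xfree : free X.
  rewrite -[X]/(tval (in_tuple X)); apply/freeP => k kE i.
  have iX := ltn_ord i; have [Oi _] := nthX i iX.
  have : ip (\sum_(j < size X) k j *: X`_j) X`_i = 0 by rewrite kE ip0l.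
  rewrite (bigD1 i) //= ipDl ipZl (orbit_norm rd Oi).
  rewrite (_ : ip (\sum_(_ < _ | _) _) _ = 0).
    move/eqP; rewrite addr0 mulf_eq0 (negPf (orbit_norm_neq0 rd beta_root)) orbF.
    by move/eqP.
  elim/big_ind: _ => [|x y Hx Hy|j ji]; first exact: ip0l.
    by rewrite ipDl Hx Hy addr0.
  by rewrite ipZl orthX ?mulr0.
have Xspan c : is_root L c -> c \in <<X>>%VS.
  have OX b : O b -> b \in <<X>>%VS.
    by case/incX => i iX [->|->]; rewrite ?rpredN memv_span // mem_nth.
  move=> rc; case: (root_shape rd beta_root beta_even rc) => [/OX //|].
  move=> [b [b' [Ob Ob' _ ->]]]; by rewrite memvZ // rpredB // OX.
have Xsize : size X = l.+1.
  rewrite -(eqP Xfree) -dim_dual; congr (\dim _); apply/eqP.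
  rewrite eqEsubv subvf /=; move: alphaB; rewrite basisEdim => /andP[+ _].
  move/subv_trans; apply; apply/span_subvP => _ /tnthP[i ->].
  by rewrite tnth_mktuple Xspan //; case: base_alpha.
exists (fun i => X`_i); split=> [i|i|i j ij|b Ob].
- by case: (nthX i); rewrite ?Xsize.
- by case: (nthX i); rewrite ?Xsize.
- have [iX jX] : (i < size X)%N /\ (j < size X)%N by rewrite Xsize !ltn_ord.
  have lt_tr : transitive lt by move=> a b c; rewrite /lt => ab ca; exact: le_trans ab.
  rewrite lt_neqAle; apply/andP; split; last first.
    by have := sorted_ltn_nth lt_tr 0 Xs i j iX jX ij.
  have [[Oi _] [Oj _]] := (nthX i iX, nthX j jX).
  have ji : j != i :> nat by rewrite gtn_eqF.
  have r := half_difference_root rd beta_root beta_even Oj Oi (orthX _ _ jX iX ji).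
  have := height_root_neq0 r.
  by rewrite heightZ heightD heightN mulf_eq0 negb_or subr_eq0 => /andP[].
- have [i iX bE] := incX b Ob; rewrite Xsize in iX.
  by exists (Ordinal iX).
Qed.
End Frame.

(** * The simple roots of type C *)

Section TypeC.
Variables (C : numClosedFieldType) (g : vectType C) (L : lie_bracket g).
Variable h : {vspace g}.
Hypothesis rd : root_datum L h.
Variables (l : nat) (alpha : 'I_l.+1 -> dual h).
Hypothesis base_alpha : is_base L alpha.
Variable beta : dual h.
Hypothesis beta_root : is_root L beta.
Hypothesis beta_even :
  forall c, is_root L c -> exists m : int, beta (tau L c) = (2 * m)%:~R.

Local Notation O := (weyl_orbit L beta).
Local Notation N := (@ip C g L h beta beta).
Local Notation ip := (@ip C g L h).
Local Notation ht := (height alpha).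
Implicit Types a b c u v : dual h.

Variable E : 'I_l.+1 -> dual h.
Hypothesis E_orbit : forall i, O (E i).
Hypothesis E_gt0 : forall i, 0 < ht (E i).
Hypothesis E_decr : forall i j : 'I_l.+1, (i < j)%N -> ht (E j) < ht (E i).
Hypothesis E_all : forall b, O b -> exists i, b = E i \/ b = - E i.

Let N0 : N != 0.
Proof. exact (orbit_norm_neq0 rd beta_root). Qed.

Let E_root i : is_root L (E i).
Proof. exact (orbit_root rd beta_root (E_orbit i)). Qed.

Lemma frame_ip i j : ip (E i) (E j) = N * (i == j)%:R.
Proof.
have [<-|ij] := eqVneq i j; first by rewrite mulr1 (orbit_norm rd (E_orbit i)).
rewrite mulr0.
case: (orbit_trichotomy rd beta_root beta_even (E_orbit i) (E_orbit j)) => // e.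
  case/negP: ij; case: (ltngtP i j) => [/E_decr|/E_decr|/val_inj/eqP //];
    by rewrite e ltxx.
by have := E_gt0 j; rewrite e heightN oppr_gt0 => /(lt_trans (E_gt0 i)); rewrite ltxx.
Qed.

Lemma frame_half_sub i j : i != j -> is_root L (2^-1 *: (E i - E j)).
Proof.
move=> ij; apply: (half_difference_root rd beta_root beta_even) => //.
by rewrite frame_ip (negPf ij) mulr0.
Qed.

Lemma frame_root_cases c : is_root L c ->
  (exists i, c = E i \/ c = - E i) \/
  (exists i j, [/\ i != j & [\/ c = 2^-1 *: (E i - E j), c = 2^-1 *: (E i + E j)
                              | c = - (2^-1 *: (E i + E j))]]).
Proof.
move=> rc; case: (root_shape rd beta_root beta_even rc) => [/E_all|]; first by left.
move=> [b [b' [/E_all[i bE] /E_all[j bE'] orth cE]]]; right.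
have ij : i != j.
  apply/eqP => ij; move/eqP: orth; rewrite -{j}ij in bE'.
  by case: bE bE' => -> [] ->; rewrite ?(ipNl, ipNr rd) ?opprK ?oppr_eq0;
    rewrite frame_ip eqxx mulr1 (negPf N0).
case: bE bE' cE => -> [] -> cE.
- by exists i, j; split=> //; constructor 1.
- by exists i, j; split=> //; constructor 2; rewrite cE opprK.
- by exists i, j; split=> //; constructor 3; rewrite cE -opprD scalerN.
- by exists j, i; split; rewrite 1?eq_sym //; constructor 1; rewrite cE opprK addrC.
Qed.

(** In the usual model these are e_i - e_(i+1) and 2 e_n, the standard base of
    type C. *)
Definition standard_simple (i : 'I_l.+1) : dual h :=
  if i == ord_max then E i else 2^-1 *: (E i - E (inord i.+1)).
Local Notation delta := standard_simple.

Let next_lt (i : 'I_l.+1) : i != ord_max -> (i.+1 < l.+1)%N.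
Proof.
move=> im; rewrite ltnS ltn_neqAle -ltnS ltn_ord andbT.
by apply: contra im => /eqP il; apply/eqP/val_inj.
Qed.

Let next_val (i : 'I_l.+1) : i != ord_max -> (inord i.+1 : 'I_l.+1) = i.+1 :> nat.
Proof. by move/next_lt => il; rewrite inordK. Qed.

Lemma standard_simple_root i : is_root L (delta i).
Proof.
rewrite /delta; case: ifP => [_|/negbT im]; first exact: E_root.
apply: frame_half_sub; apply/eqP => /(congr1 val) /= /eqP.
by rewrite next_val // ltn_eqF.
Qed.

Lemma standard_simple_gt0 i : 0 < ht (delta i).
Proof.
rewrite /delta; case: ifP => [_|/negbT im]; first exact: E_gt0.
rewrite heightZ heightD heightN mulr_gt0 ?invr_gt0 ?ltr0n // subr_gt0.
by apply: E_decr; rewrite next_val.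
Qed.

Let dpos v := nonneg_comb delta v.

Let dpos0 : dpos 0.
Proof. by exists (fun=> 0%N); rewrite big1. Qed.

Let dposD u v : dpos u -> dpos v -> dpos (u + v).
Proof.
move=> [c ->] [d ->]; exists (fun i => c i + d i)%N.
by rewrite -big_split; apply: eq_bigr => i _; rewrite mulrnDr.
Qed.

Let dpos_delta i : dpos (delta i).
Proof.
exists (fun j => (j == i) : nat); rewrite (bigD1 i) //= eqxx big1 ?addr0 //.
by move=> j /negPf ->.
Qed.

Let dpos_sub (i j : 'I_l.+1) : (i <= j)%N -> dpos (2^-1 *: (E i - E j)).
Proof.
move=> ij; suff H k : (i + k < l.+1)%N -> dpos (2^-1 *: (E i - E (inord (i + k)))).
  by have := H (j - i)%N; rewrite subnKC // inord_val; apply.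
elim: k => [|k IH] kl; first by rewrite addn0 inord_val subrr scaler0; exact: dpos0.
have kl' : (i + k < l.+1)%N by rewrite (leq_trans _ kl) // addnS.
have := dposD (IH kl') (dpos_delta (inord (i + k))).
rewrite /delta ifF; last first.
  apply/negbTE/eqP => /(congr1 val); rewrite /= inordK // => e.
  by move: kl; rewrite addnS e ltnn.
by rewrite -scalerDr addrA subrK inordK // addnS.
Qed.

Let dpos_E i : dpos (E i).
Proof.
have m : dpos (2^-1 *: (E i - E ord_max)) by apply: dpos_sub; rewrite -ltnS.
have := dposD (dposD m m) (dpos_delta ord_max); rewrite /delta eqxx.
by rewrite -mulr2n -scaler_nat scalerA divff ?pnatr_eq0 // scale1r subrK.
Qed.

Let dpos_add i j : dpos (2^-1 *: (E i + E j)).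
Proof.
have m k : dpos (2^-1 *: (E k - E ord_max)) by apply: dpos_sub; rewrite -ltnS.
have := dposD (dposD (m i) (m j)) (dpos_E ord_max).
congr dpos; rewrite -scalerDr -[X in _ + X]half_half -scalerDr mulr2n.
by rewrite addrACA !subrK.
Qed.

(** 2 e_i, e_i + e_j and, for i < j, e_i - e_j are the positive roots. *)
Lemma positive_root_comb c : is_root L c -> 0 < ht c -> nonneg_comb delta c.
Proof.
move=> rc c0; have h2 : 0 < 2^-1 :> C by rewrite invr_gt0 ltr0n.
case: (frame_root_cases rc) => [[i [cE|cE]]|[i [j [ij [cE|cE|cE]]]]].
- by rewrite cE; exact: dpos_E.
- by move: c0; rewrite cE heightN oppr_gt0 => /(lt_trans (E_gt0 i)); rewrite ltxx.
- rewrite cE; apply: dpos_sub; rewrite leqNgt; apply/negP => /E_decr ji.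
  move: c0; rewrite cE heightZ heightD heightN pmulr_rgt0 // subr_gt0.
  by move/(lt_trans ji); rewrite ltxx.
- by rewrite cE; exact: dpos_add.
- move: c0; rewrite cE heightN heightZ heightD oppr_gt0 pmulr_rlt0 //.
  by move/(lt_trans (addr_gt0 (E_gt0 i) (E_gt0 j))); rewrite ltxx.
Qed.

(** A simple root is a combination with natural coefficients of the standard
    ones; its height is 1 and theirs are at least 1, so it is one of them. *)
Lemma simple_is_standard i : exists j, alpha i = delta j.
Proof.
have [ra aB _] := base_alpha.
have hti : ht (alpha i) = 1.
  have := height_nonneg_comb base_alpha (fun j => (j == i) : nat).
  rewrite (bigD1 i) //= eqxx big1 => [|j /negPf -> //]; rewrite addr0 => ->.
  by rewrite (bigD1 i) //= eqxx big1 // => j /negPf ->.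
have ht_gt0 : 0 < ht (alpha i) by rewrite hti ltr01.
have [c cE] := positive_root_comb (ra i) ht_gt0.
have /choice[n nE] : forall j, exists n, ht (delta j) = n.+1%:R.
  move=> j; have rj := standard_simple_root j.
  exact: (height_gt0_nat base_alpha rj (standard_simple_gt0 j)).
have sum1 : (\sum_j c j * (n j).+1 = 1)%N.
  apply/eqP; rewrite -(eqr_nat C) natr_sum -[X in _ == X]hti cE; apply/eqP.
  rewrite (big_morph ht (heightD alpha) (_ : ht 0 = 0)).
    by apply: eq_bigr => j _; rewrite natrM -nE -scaler_nat heightZ.
  by rewrite -[0 in LHS](scale0r 0) heightZ mul0r.
have [j cj] : exists j, c j != 0%N.
  apply: contrapT => no; move/eqP: sum1; rewrite big1 // => j _.
  by have [->|nz] := eqVneq (c j) 0%N; [rewrite mul0n | case: no; exists j].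
exists j; rewrite cE (bigD1 j) //= big1.
  rewrite addr0; move: sum1; rewrite (bigD1 j) //=; case: (c j) cj => [//|[//|k]] _.
  by rewrite !mulSn => /eqP; rewrite !addSn !addnS.
move=> k kj; move: sum1; rewrite (bigD1 j) //= (bigD1 k) //=.
case: (c j) cj => [//|cj] _; case: (c k) => [//|ck]; nia.
Qed.

Lemma simple_numbering : exists p : {perm 'I_l.+1}, forall j, alpha (p j) = delta j.
Proof.
have [f fE] := choice simple_is_standard.
have f_inj : injective f.
  move=> i j ij; have : alpha i = alpha j by rewrite !fE ij.
  have [_ /basis_free/free_uniq aU _] := base_alpha.
  move/eqP; rewrite -(nth_mktuple alpha 0 i) -(nth_mktuple alpha 0 j).
  by rewrite nth_uniq ?size_tuple // => /eqP/val_inj.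
exists (perm f_inj)^-1%g => j.
by rewrite fE -[in RHS](permKV (perm f_inj) j) permE.
Qed.

(** Half the members of the frame are the unit vectors e_i of the usual model, and
    the coroot of e_j - e_(j+1) is itself, that of 2 e_n is e_n. *)
Lemma frame_pair i j : (2^-1 *: E i) (tau L (delta j)) =
  (i == j)%:R - (i == j.+1 :> nat)%:R :> C.
Proof.
have h2 : 2 != 0 :> C by rewrite pnatr_eq0.
rewrite (rd_pair rd) /delta; case: ifP => [/eqP -> |/negbT jm].
  rewrite ipZl !frame_ip eqxx (ltn_eqF (ltn_ord i)) subr0 mulr1.
  by move: ((i == ord_max)%:R : C) => x; field; exact: N0.
rewrite !(ipE rd) !frame_ip eqxx.
have -> : (j == inord j.+1) = false.
  by apply/negbTE/eqP => /(congr1 val)/eqP; rewrite /= next_val // ltn_eqF.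
have -> : (inord j.+1 == j :> 'I_l.+1) = false.
  by apply/negbTE/eqP => /(congr1 val)/eqP; rewrite /= next_val // gtn_eqF.
have -> : (i == inord j.+1) = (i == j.+1 :> nat) by rewrite -val_eqE /= next_val.
rewrite eqxx !mulr1 !mulr0.
move: ((i == j)%:R : C) ((i == j.+1 :> nat)%:R : C) => x y.
by field; rewrite opprK -mulr2n mulrn_eq0 negb_or N0.
Qed.

Lemma standard_cartan_C i j : delta i (tau L (delta j)) = (cartan_C i j)%:~R.
Proof.
have dE : delta i = if i == ord_max then (2^-1 *: E i) *+ 2
                     else 2^-1 *: E i - 2^-1 *: E (inord i.+1).
  rewrite /delta; case: ifP => _; last by rewrite scalerBr.
  by rewrite -scaler_nat scalerA divff ?scale1r // pnatr_eq0.
rewrite dE /cartan_C; case: ifP => [/eqP im|/negbT im].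
  rewrite mulr2n add_lfunE frame_pair.
  have -> : (j == i.+1 :> nat) = false by rewrite im ltn_eqF ?ltn_ord.
  have [->|ij] := eqVneq i j; first by rewrite (ltn_eqF (ltnSn _)) subr0.
  by case: eqP => _; rewrite ?subr0 ?addr0 // sub0r -opprD.
have nj : (inord i.+1 == j :> 'I_l.+1) = (j == i.+1 :> nat).
  by rewrite -val_eqE /= next_val // eq_sym.
have ij_nat : (i == j :> nat) = (i == j) by [].
rewrite add_lfunE opp_lfunE !frame_pair next_val // eqSS nj ij_nat.
have [->|ij] := eqVneq i j.
  by rewrite !(ltn_eqF (ltnSn _)) /= !subr0 sub0r opprK.
case: (eqVneq (j : nat) i.+1) => [jE|_] /=.
  by rewrite jE (ltn_eqF (ltnW (ltnSn _))) //= !subr0 sub0r.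
by case: eqP => _ //=; rewrite !subr0 ?sub0r ?subr0.
Qed.

(** Half of the first member of the frame, e_1, pairs to 1 with the first simple
    coroot and to 0 with the others. *)
Lemma frame_fundamental (omega : 'I_l.+1 -> dual h) (p : {perm 'I_l.+1}) :
    fundamental_weights L alpha omega -> (forall j, alpha (p j) = delta j) ->
  omega (p ord0) = 2^-1 *: E ord0.
Proof.
move=> fund pE; apply/eqP; rewrite -subr_eq0; apply/eqP.
apply: (ip_nondeg rd base_alpha) => i.
rewrite -(permKV p i) pE (ip_pair rd); last exact: standard_simple_root.
rewrite add_lfunE opp_lfunE -{1}pE fund frame_pair (inj_eq perm_inj) subr0.
by rewrite subrr !mul0r.
Qed.

(** Roots outside the orbit have half the norm, so the long roots are those of
    the orbit, and the first member of the frame is the highest of these. *)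
Lemma frame_highest beta_max : highest_long_root L alpha beta_max -> beta_max = E ord0.
Proof.
case=> -[rb long] high.
have norm_half i j : i != j ->
    ip (2^-1 *: (E i - E j)) (2^-1 *: (E i - E j)) = N / 2 /\
    ip (2^-1 *: (E i + E j)) (2^-1 *: (E i + E j)) = N / 2.
  move=> ij; rewrite !(ipE rd) !frame_ip !eqxx (eq_sym j i) (negPf ij) !mulr1 !mulr0.
  by split; field.
have Npos : 0 < N by exact: (rd_norm_gt0 rd beta_root).
have half_lt : N / 2 < N by rewrite ltr_pdivrMr ?ltr0n // ltr_pMr // ltr1n.
have short c : is_root L c -> norm2 L c <= N.
  move=> rc; rewrite (rd_norm2 rd); case: (frame_root_cases rc).
    by move=> [i [->|->]]; rewrite ?(ipNl, ipNr rd) ?opprK (orbit_norm rd (E_orbit i)).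
  move=> [i [j [ij [->|->|->]]]]; rewrite ?(ipNl, ipNr rd) ?opprK;
    by case: (norm_half _ _ ij) => n1 n2; rewrite ?n1 ?n2 ltW.
have long0 : long_root L (E ord0).
  split=> // c rc; rewrite (rd_norm2 rd (E _)) (orbit_norm rd (E_orbit _)); exact: short.
have big : N <= ip beta_max beta_max.
  by rewrite -(orbit_norm rd (E_orbit ord0)) -!(rd_norm2 rd); apply: long.
have [c cE] := high _ long0.
have hb : ht (E ord0) <= ht beta_max.
  rewrite -subr_ge0 -(heightN alpha) -(heightD alpha) cE.
  by rewrite (height_nonneg_comb base_alpha) ler0n.
have notbig x : N <= x -> x = N / 2 -> False.
  by move=> Nx xE; move: half_lt; rewrite -xE => /(le_lt_trans Nx); rewrite ltxx.
case: (frame_root_cases rb) => [[i [bE|bE]]|[i [j [ij bE]]]].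
- rewrite bE; congr E; apply/val_inj/eqP; rewrite -leqn0 leqNgt; apply/negP => i0.
  by have := @E_decr ord0 i i0; rewrite -bE => /(le_lt_trans hb); rewrite ltxx.
- have := E_gt0 i; rewrite -oppr_lt0 -(heightN alpha) -bE => /(le_lt_trans hb).
  by move/(lt_trans (E_gt0 ord0)); rewrite ltxx.
case: (norm_half _ _ ij) => n1 n2; exfalso; apply: (notbig _ big).
by case: bE => ->; rewrite ?(ipNl, ipNr rd) ?opprK ?n1 ?n2.
Qed.

Let weyl_swap i j : exists w, weyl L w /\ forall m, w (E m) = E (tperm i j m).
Proof.
have [<-|ij] := eqVneq i j.
  by exists id; split=> [|m]; [exact: weyl1 | rewrite tperm1 perm1].
exists (reflection L (2^-1 *: (E i - E j))); split.
  exact/weyl_reflection/frame_half_sub.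
move=> m.
have -> : reflection L (2^-1 *: (E i - E j)) (E m) =
    E m - ((m == i)%:R - (m == j)%:R) *: (E i - E j).
  have pair : (E m) (tau L (2^-1 *: (E i - E j))) = 2 * ((m == i)%:R - (m == j)%:R) :> C.
    rewrite (rd_pair rd) !(ipE rd) !frame_ip !eqxx (eq_sym j i) (negPf ij) !mulr1 !mulr0.
    move: ((m == i)%:R : C) ((m == j)%:R : C) => x y.
    by field; rewrite opprK -mulr2n mulrn_eq0 negb_or N0.
  by rewrite /reflection pair scalerA mulrAC divff ?mul1r // pnatr_eq0.
case: tpermP => [->|->|/eqP/negPf -> /eqP/negPf ->].
- by rewrite eqxx (negPf ij) subr0 scale1r opprB addrC subrK.
- by rewrite eqxx eq_sym (negPf ij) sub0r scaleN1r opprK addrC subrK.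
- by rewrite subrr scale0r subr0.
Qed.

Let weyl_flip j : exists w,
  [/\ weyl L w, w (E j) = - E j & forall m, m != j -> w (E m) = E m].
Proof.
exists (reflection L (E j)); split=> [||m mj].
- exact: weyl_reflection.
- exact: reflection_self.
- by apply: (reflection_orth rd); rewrite frame_ip (negPf mj) mulr0.
Qed.

(** Representatives 2 e_1, 2 e_n, e_1 - e_2 and e_2 - e_3, for the action of the
    stabilizer of e_1 on the roots up to sign. *)
Definition normal_root t : Prop :=
  [\/ t = E ord0, (0 < l)%N /\ t = E ord_max,
      (0 < l)%N /\ t = 2^-1 *: (E ord0 - E (inord 1))
    | (1 < l)%N /\ t = 2^-1 *: (E (inord 1) - E (inord 2))].

Let reaches a := exists w, [/\ weyl L w, w (E ord0) = E ord0
  & exists2 t, normal_root t & w a = t \/ w a = - t].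

Let reachesN a : reaches a -> reaches (- a).
Proof.
move=> [w [ww w0 [t nt wt]]]; exists w; split=> //; exists t => //.
by rewrite (weylN _ ww); case: wt => ->; rewrite ?opprK; [right|left].
Qed.

Let reaches_weyl w a : weyl L w -> w (E ord0) = E ord0 -> reaches (w a) -> reaches a.
Proof.
move=> ww w0 [w' [ww' w0' H]]; exists (w' \o w); split=> //=.
  exact: weyl_comp.
by rewrite w0.
Qed.

Let reaches_normal t : normal_root t -> reaches t.
Proof. by move=> nt; exists id; split=> //; [exact: weyl1 | exists t => //; left]. Qed.

Let weyl_half w i j : weyl L w ->
  w (2^-1 *: (E i - E j)) = 2^-1 *: (w (E i) - w (E j)).
Proof. by move=> ww; rewrite (weylZ _ _ ww) (weylD _ _ ww) (weylN _ ww). Qed.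

Let ordP (i : 'I_l.+1) : i != ord0 -> (0 < l)%N.
Proof. by move=> i0; have := ltn_ord i; move: i0; rewrite -val_eqE /=; lia. Qed.

Let reaches_E i : reaches (E i).
Proof.
have [->|i0] := eqVneq i ord0; first by apply: reaches_normal; constructor 1.
have l0 := ordP i0; have [w [ww wE]] := weyl_swap i ord_max.
apply: (reaches_weyl ww); rewrite wE ?tpermL ?tpermD //.
  by rewrite -val_eqE /= -lt0n.
by apply: reaches_normal; constructor 2.
Qed.

Let reaches_sub i j : i != j -> j != ord0 -> reaches (2^-1 *: (E i - E j)).
Proof.
move=> ij j0; have l0 := ordP j0.
have o1 : (inord 1 : 'I_l.+1) = 1%N :> nat by rewrite inordK.
have n1 : inord 1 != ord0 :> 'I_l.+1 by rewrite -val_eqE /= o1.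
have [i0|i0] := eqVneq i ord0.
  have [w [ww wE]] := weyl_swap j (inord 1).
  have w0 : w (E ord0) = E ord0 by rewrite wE tpermD.
  apply: (reaches_weyl ww w0); rewrite weyl_half // i0 w0 wE tpermL.
  by apply: reaches_normal; constructor 3.
have l1 : (1 < l)%N.
  have := ltn_ord i; have := ltn_ord j; move: i0 j0 ij; rewrite -!val_eqE /=; lia.
have o2 : (inord 2 : 'I_l.+1) = 2%N :> nat by rewrite inordK.
have n2 : inord 2 != ord0 :> 'I_l.+1 by rewrite -val_eqE /= o2.
have n12 : inord 2 != inord 1 :> 'I_l.+1 by rewrite -val_eqE /= o1 o2.
have [w [ww wE]] := weyl_swap i (inord 1).
have w0 : w (E ord0) = E ord0 by rewrite wE tpermD.
apply: (reaches_weyl ww w0); rewrite weyl_half // !wE tpermL.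
set j' := tperm _ _ j.
have j'1 : j' != inord 1 by rewrite -[X in _ != X](tpermL i) (inj_eq perm_inj) eq_sym.
have j'0 : j' != ord0.
  by rewrite -(tpermD i0 n1) (inj_eq perm_inj).
have [w' [ww' wE']] := weyl_swap j' (inord 2).
have w0' : w' (E ord0) = E ord0 by rewrite wE' tpermD.
apply: (reaches_weyl ww' w0'); rewrite weyl_half // !wE' tpermL tpermD //.
by apply: reaches_normal; constructor 4.
Qed.

Let reaches_add i j : i != j -> j != ord0 -> reaches (2^-1 *: (E i + E j)).
Proof.
move=> ij j0; have [w [ww wj wE]] := weyl_flip j.
apply: (reaches_weyl ww); first by rewrite wE // eq_sym.
by rewrite (weylZ _ _ ww) (weylD _ _ ww) wj wE //; exact: reaches_sub.
Qed.

(** Reflections in e_i - e_j and in 2 e_j permute the e_i and change their signs;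
    those not involving e_1 carry every root to a representative. *)
Lemma root_normal_form a : is_root L a -> exists w,
  [/\ weyl L w, w (E ord0) = E ord0 & exists2 t, normal_root t & w a = t \/ w a = - t].
Proof.
move=> ra; rewrite -/(reaches a).
case: (frame_root_cases ra) => [[i [->|->]]|[i [j [ij aE]]]].
- exact: reaches_E.
- exact/reachesN/reaches_E.
have [j0|j0] := eqVneq j ord0; last first.
  case: aE => ->; [exact: reaches_sub|exact: reaches_add|exact/reachesN/reaches_add].
have i0 : i != ord0 by rewrite -j0.
have ji : j != i by rewrite eq_sym.
case: aE => ->.
- by rewrite -opprB scalerN; exact/reachesN/reaches_sub.
- by rewrite addrC; exact: reaches_add.
- by rewrite addrC; exact/reachesN/reaches_add.
Qed.

End TypeC.

(** * Fundamental weights and the classification *)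

Lemma odd_multiple (V : zmodType) (v : V) (k : int) :
  v *~ (2 * k + 1) = v + (v *+ 2) *~ k.
Proof. by rewrite mulrzDr mulr1z addrC mulrzA. Qed.

(** The nested conditionals as a sum of Kronecker symbols. *)
Lemma cartan_CE l (i j : 'I_l.+1) : cartan_C i j =
  2 * (i == j)%:R - (j == i.+1 :> nat)%:R
    - (1 + (i == ord_max))%:R * (i == j.+1 :> nat)%:R.
Proof.
rewrite /cartan_C; have [->|ij] := eqVneq i j.
  by rewrite (ltn_eqF (ltnSn _)) !mulr0 !subr0.
case: (eqVneq (j : nat) i.+1) => [->|ji].
  by rewrite (ltn_eqF (ltnW (ltnSn _))) !mulr0 subr0.
by case: eqP => _; [case: eqP|]; rewrite ?mulr0.
Qed.

Section Weights.
Variables (C : numClosedFieldType) (g : vectType C) (L : lie_bracket g).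
Variable h : {vspace g}.
Hypothesis rd : root_datum L h.
Variables (l : nat) (alpha omega : 'I_l.+1 -> dual h).
Hypothesis base_alpha : is_base L alpha.
Hypothesis fund_omega : fundamental_weights L alpha omega.

Let simple_root i : is_root L (alpha i).
Proof. by case: base_alpha. Qed.

Lemma weight_ext (u v : dual h) (p : {perm 'I_l.+1}) :
  (forall j, u (tau L (alpha (p j))) = v (tau L (alpha (p j)))) -> u = v.
Proof.
move=> uv; apply/eqP; rewrite -subr_eq0; apply/eqP.
apply: (ip_nondeg rd base_alpha) => i.
rewrite -(permKV p i) (ip_pair rd _ (simple_root _)).
by rewrite add_lfunE opp_lfunE uv subrr !mul0r.
Qed.

Lemma double_omega_pair (p : {perm 'I_l.+1}) i j :
  (omega (p i) *+ 2) (tau L (alpha (p j))) = 2 * (i == j)%:R :> C.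
Proof. by rewrite -scaler_nat scale_lfunE fund_omega (inj_eq perm_inj). Qed.

Lemma double_omega_root_A1 (p : {perm 'I_l.+1}) :
  l = 0%N -> is_root L (omega (p ord0) *+ 2).
Proof.
move=> l0; rewrite (_ : _ *+ 2 = alpha (p ord0)) //.
apply: (@weight_ext _ _ p) => j; have -> : j = ord0.
  by apply/val_inj; have := ltn_ord j; rewrite /= {2}l0; case: (j : nat).
by rewrite double_omega_pair eqxx mulr1 (tau_self rd).
Qed.

(** Reflecting the long simple root successively in the other simple roots, from
    the last to the first, leads to twice the first fundamental weight. *)
Lemma double_omega_root_C (p : {perm 'I_l.+1}) :
  numbered_C L (fun i => alpha (p i)) -> (0 < l)%N -> is_root L (omega (p ord0) *+ 2).
Proof.
move=> num l0.
(* The root 2 e_(l - k), with indices starting from 0, given by its pairings with the simple coroots. *)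
have chain k : (k <= l)%N -> exists2 v, is_root L v & forall j : 'I_l.+1,
    v (tau L (alpha (p j))) = 2 * ((l - k == j)%N%:R - (l - k == j.+1)%N%:R) :> C.
  elim: k => [_|k IH kl].
    exists (alpha (p ord_max)) => // j; rewrite num cartan_CE subn0 eqxx.
    rewrite (ltn_eqF (ltn_ord j)) subr0 -val_eqE /=.
    by rewrite rmorphB !rmorphM /= !natz -!pmulrn mulrBr.
  have [v rv vE] := IH (ltnW kl).
  pose i : 'I_l.+1 := inord (l - k.+1).
  have iE : i = (l - k.+1)%N :> nat by rewrite inordK // ltnS leq_subr.
  have iS : (l - k = i.+1)%N by rewrite iE; lia.
  exists (reflection L (alpha (p i)) v); first exact: reflection_root.
  move=> j; rewrite -iE iS in vE *.
  have im : (i == ord_max) = false by rewrite -val_eqE /= iE; lia.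
  rewrite /reflection add_lfunE opp_lfunE scale_lfunE !vE num cartan_CE im.
  rewrite (gtn_eqF (ltnSn _)) eqxx eqSS -[(i == j :> nat)]/(i == j).
  rewrite -[_ *: _]/(_ * _) !rmorphB !rmorphM /= !natz -!pmulrn eq_sym.
  ring.
have [v rv vE] := chain l (leqnn l).
suff -> : omega (p ord0) *+ 2 = v by [].
by apply: (@weight_ext _ _ p) => j; rewrite double_omega_pair vE subnn subr0.
Qed.

Variables (mu : dual h) (k : int).

(** An element w of the Weyl group maps 2 (om + k' t) to 2 k' w(t) + w(2 om), and
    the sign of k' moves to the root w(t). *)
Lemma decomposition_of_orbit (om t : dual h) k' :
    is_root L (om *+ 2) -> is_root L t -> k' = k \/ k' = - k ->
    weyl_orbit L mu = weyl_orbit L (om + t *~ k') ->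
  exists a b : dual h, [/\ is_root L a, is_root L b & mu *+ 2 = a *~ (2 * k) + b].
Proof.
move=> ro rt kk' W; have [w ww ->] : weyl_orbit L (om + t *~ k') mu.
  by rewrite -W; exact: weyl_orbit_refl.
have E : w (om + t *~ k') *+ 2 = w t *~ (2 * k') + w (om *+ 2).
  rewrite -!scaler_nat -!scaler_int (weylZ _ _ ww) !(weylD _ _ ww) !(weylZ _ _ ww).
  by rewrite scalerDr addrC intrM scalerA.
have [rwo rwt] := (weyl_root rd ww ro, weyl_root rd ww rt).
case: kk' => kE; [exists (w t)|exists (- w t)]; exists (w (om *+ 2)); split=> //.
- by rewrite E kE.
- exact: root_opp.
- by rewrite E kE mulrN mulrNz mulNrz.
Qed.

Hypothesis mu_weight : abstract_weight L mu.

Lemma decomposition_even a b :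
    is_root L a -> is_root L b -> mu *+ 2 = a *~ (2 * k) + b ->
  forall c, is_root L c -> exists m : int, b (tau L c) = (2 * m)%:~R.
Proof.
move=> ra rb E c rc; have [m mE] := mu_weight rc; have [n [nE _]] := rd_refl rd rc ra.
have bE : b = mu *+ 2 - a *~ (2 * k) by rewrite E addrAC subrr add0r.
exists (m - k * n); rewrite bE -scaler_nat -scaler_int.
rewrite add_lfunE opp_lfunE !scale_lfunE mE nE.
by rewrite -![_ *: _]/(_ * _) !(intrM, rmorphB) /= intrM; ring.
Qed.

End Weights.

Theorem proposition9p2 (R : realType) (g : vectType R[i]) (L : lie_bracket g)
    (h : {vspace g}) (l : nat) (alpha omega : 'I_l.+1 -> dual h)
    (beta_max : dual h)
    (simple_g : lie_simple L)
    (cartan_h : cartan_subalgebra L h)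
    (base_alpha : is_base L alpha)
    (fund_omega : fundamental_weights L alpha omega)
    (beta_maxP : highest_long_root L alpha beta_max)
    (mu : dual h) (mu_weight : abstract_weight L mu) (k : int) :
  (exists a b : dual h,
     [/\ is_root L a, is_root L b & mu *+ 2 = a *~ (2 * k) + b])
  <->
  (exists (s : {perm 'I_l.+1}) (k' : int), (k' = k \/ k' = - k) /\
    let al := fun i => alpha (s i) in
    let om := fun i => omega (s i) in
    let W := @weyl_orbit _ _ L h in
    [\/ (* A_1 *)
        l.+1 = 1%N /\ W mu = W (om ord0 *~ (2 * k' + 1)),
        (* C_n, n >= 3 *)
        [/\ (3 <= l.+1)%N, numbered_C L al
          & [\/ W mu = W (om ord0 + al ord0 *~ k'),
                W mu = W (om ord0 + al (inord 1) *~ k'),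
                W mu = W (om ord0 + al ord_max *~ k')
              | W mu = W (om ord0 *~ (2 * k' + 1)) /\
                om ord0 *~ (2 * k' + 1) = om ord0 + beta_max *~ k']]
      | (* C_2 *)
        [/\ l.+1 = 2%N, numbered_C L al
          & [\/ W mu = W (om ord0 + al ord0 *~ k'),
                W mu = W (om ord0 + al (inord 1) *~ k')
              | W mu = W (om ord0 *~ (2 * k' + 1)) /\
                om ord0 *~ (2 * k' + 1) = om ord0 + beta_max *~ k']]]).
Proof.
have [_ alphaB _] := base_alpha.
have rd := lie_root_datum simple_g cartan_h (corootP alphaB fund_omega).
split=> [[a [b [ra rb E]]]|[p [k' [kk']]] /=].
  have even := decomposition_even rd mu_weight ra rb E.
  have [F [FO F0 Fd Fa]] := orthogonal_frame rd base_alpha rb even.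
  have [p pE] := simple_numbering rd base_alpha rb even FO F0 Fd Fa.
  have omE := frame_fundamental rd base_alpha rb even FO F0 Fd fund_omega pE.
  have bmE := frame_highest rd base_alpha rb even FO F0 Fd Fa beta_maxP.
  have [w1 ww1 w1E] := FO ord0.
  have [w2 [ww2 w2E [t nt wt]]] :=
    root_normal_form rd rb even FO F0 Fd Fa (weyl_root rd ww1 ra).
  have num : numbered_C L (fun i => alpha (p i)).
    by move=> i j; rewrite !pE; exact (standard_cartan_C rd rb even FO F0 Fd i j).
  have F0E : F ord0 = omega (p ord0) *+ 2.
    by rewrite omE -scaler_nat scalerA divff ?scale1r // pnatr_eq0.
  have [k' [kk' wmu]] : exists k', (k' = k \/ k' = - k) /\
      w2 (w1 mu) = omega (p ord0) + t *~ k'.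
    have muE : w2 (w1 mu) = w2 (w1 a) *~ k + omega (p ord0).
      have muE : mu = k%:~R *: a + 2^-1 *: b.
        rewrite -[mu]half_half E -scaler_int scalerDr scalerA intrM.
        by rewrite mulrA mulVf ?mul1r // pnatr_eq0.
      rewrite muE (weylD _ _ ww1) !(weylZ _ _ ww1) (weylD _ _ ww2) !(weylZ _ _ ww2).
      by rewrite -w1E w2E -omE scaler_int.
    case: wt => wt; [exists k | exists (- k)]; split; [by left| |by right|].
      by rewrite muE wt addrC.
    by rewrite muE wt addrC mulrNz mulNrz.
  have W : weyl_orbit L mu = weyl_orbit L (omega (p ord0) + t *~ k').
    by rewrite -wmu (weyl_orbitE rd _ ww2) (weyl_orbitE rd _ ww1).
  exists p, k'; split=> //=.
  have odd_mult : omega (p ord0) *~ (2 * k' + 1) = omega (p ord0) + F ord0 *~ k'.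
    by rewrite F0E; exact: odd_multiple.
  have lmax : alpha (p ord_max) = F ord_max by rewrite pE /standard_simple eqxx.
  have l_cases : l = 0%N \/ l = 1%N \/ (1 < l)%N by lia.
  case: nt => [tE|[l0 tE]|[l0 tE]|[l1 tE]].
  - rewrite tE -odd_mult in W.
    case: l_cases => [l0|[l1|l2]].
    + by constructor 1; split; [rewrite l0|].
    + constructor 3; split=> //; [by rewrite l1|constructor 3].
      by split; [exact: W|rewrite bmE; exact: odd_mult].
    + constructor 2; split=> //; constructor 4.
      by split; [exact: W|rewrite bmE; exact: odd_mult].
  - rewrite tE -lmax in W.
    case: l_cases => [l0'|[l1|l2]]; first by rewrite l0' in l0.
    + constructor 3; split=> //; [by rewrite l1|constructor 2].
      rewrite (_ : inord 1 = ord_max); first exact: W.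
      by apply/val_inj; rewrite /= inordK l1.
    + by constructor 2; split=> //; constructor 3.
  - have dE : alpha (p ord0) = t.
      by rewrite pE tE /standard_simple -val_eqE /= ltn_eqF.
    rewrite -dE in W.
    case: l_cases => [l0'|[l1|l2]]; first by rewrite l0' in l0.
    + by constructor 3; split=> //; [rewrite l1|constructor 1].
    + by constructor 2; split=> //; constructor 1.
  - have o1 : (inord 1 : 'I_l.+1) = 1%N :> nat by rewrite inordK // ltnS ltnW.
    have dE : alpha (p (inord 1)) = t.
      by rewrite pE tE /standard_simple -val_eqE /= o1 ltn_eqF.
    rewrite -dE in W.
    by constructor 2; split=> //; constructor 2.
have odd_mult : omega (p ord0) *~ (2 * k' + 1) =
    omega (p ord0) + (omega (p ord0) *+ 2) *~ k'.
  exact: odd_multiple.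
have ra i : is_root L (alpha i) by case: base_alpha.
case=> [[l0 W]|[l0 num W]|[l0 num W]].
- have ro := double_omega_root_A1 rd base_alpha fund_omega p (eq_add_S _ _ l0).
  by rewrite odd_mult in W; exact (decomposition_of_orbit rd ro ro kk' W).
- have ro : is_root L (omega (p ord0) *+ 2).
    by apply: (double_omega_root_C rd base_alpha fund_omega num); lia.
  case: W => [W|W|W|[W _]].
  + exact (decomposition_of_orbit rd ro (ra _) kk' W).
  + exact (decomposition_of_orbit rd ro (ra _) kk' W).
  + exact (decomposition_of_orbit rd ro (ra _) kk' W).
  + by rewrite odd_mult in W; exact (decomposition_of_orbit rd ro ro kk' W).
- have ro : is_root L (omega (p ord0) *+ 2).
    by apply: (double_omega_root_C rd base_alpha fund_omega num); lia.
  case: W => [W|W|[W _]].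
  + exact (decomposition_of_orbit rd ro (ra _) kk' W).
  + exact (decomposition_of_orbit rd ro (ra _) kk' W).
  + by rewrite odd_mult in W; exact (decomposition_of_orbit rd ro ro kk' W).
Qed.
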